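(* Fix integers $N\ge1$ and $d\ge2$. There is a constant $C_2(N,d)$ such that for every unweighted portrait $\mathcal P$ and every number field $K$ (with algebraic closure $\bar K$) we have $$\mathcal M_d^N[\mathcal P](K)\subset\mathrm{Image}\Bigl(\bigcup_{[L:K]\le C_2(N,d)}\mathrm{End}_d^N[\mathcal P](L)\longrightarrow\mathcal M_d^N[\mathcal P](\bar K)\Bigr),$$ where the union is over extensions $L/K$ inside $\bar K$. In other words, every $\xi\in\mathcal M_d^N[\mathcal P](\bar K)$ whose field of moduli is contained in $K$ has a field of definition whose degree over $K$ is bounded in terms of $N$ and $d$.
   Context: An unweighted portrait is a triple $\mathcal P=(\mathcal V^\circ,\mathcal V,\Phi)$ with $\mathcal V$ a finite set, $\mathcal V^\circ\subseteq\mathcal V$ and $\Phi:\mathcal V^\circ\to\mathcal V$ a map. $\mathrm{End}_d^N$ is the space of degree $d$ endomorphisms $f=[f_0,\dots,f_N]$ of $\mathbb P^N$ ($f_i$ homogeneous of degree $d$ without common zero). $\mathrm{End}_d^N[\mathcal P]$ is the closed subscheme of $\mathrm{End}_d^N\times((\mathbb P^N)^{\mathcal V}\smallsetminus\text{big diagonal})$ of pairs $(f,(P_v)_{v\in\mathcal V})$ (with the $P_v$ distinct) satisfying $f(P_v)=P_{\Phi(v)}$ for all $v\in\mathcal V^\circ$. $\mathrm{SL}_{N+1}$ acts by $\varphi\star(f,(P_v))=(\varphi^{-1}\circ f\circ\varphi,(\varphi^{-1}(P_v)))$ and $\mathcal M_d^N[\mathcal P]=\mathrm{End}_d^N[\mathcal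 P]/\!/\mathrm{SL}_{N+1}$ is the GIT geometric quotient; over $\bar K$ its points are the $\mathrm{PGL}_{N+1}(\bar K)$-orbits in $\mathrm{End}_d^N[\mathcal P](\bar K)$. The field of moduli of $\xi\in\mathcal M_d^N[\mathcal P](\bar K)$ is contained in $K$ iff $\xi\in\mathcal M_d^N[\mathcal P](K)$; $L$ is a field of definition for $\xi$ if $\xi$ is the image of a point of $\mathrm{End}_d^N[\mathcal P](L)$. *)

(* Defs.v *)
From HB Require Import structures.
From mathcomp Require Import all_boot all_order all_algebra all_field.
From mathcomp Require Import mpoly.

Set Implicit Arguments.
Unset Strict Implicit.
Unset Printing Implicit Defensive.

Import GRing.Theory.
Local Open Scope ring_scope.

Record portrait := Portrait {
  vert : finType;
  dom : {set vert};
  portrait_map : {v : vert | v \in dom} -> vert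
}.

(* Points of projective space and of End_d^N are handled through homogeneous
   coordinates: a point of P^N(F) is a nonzero column vector, taken up to
   [proj_eq]; an element of End_d^N(F) is an (N+1)-tuple of forms, taken up to
   a common nonzero scalar. *)
Definition proj_eq (F : fieldType) (n : nat) (x y : 'cV[F]_n) : Prop :=
  exists2 c : F, c != 0 & y = c *: x.

(* The underlying data (f, (P_v)_v) of a point of End_d^N x (P^N)^V, with
   coordinates in F. *)
Record coords (F : fieldType) (N : nat) (V : finType) := Coords {
  forms : 'I_N.+1 -> {mpoly F[N.+1]};
  pts : V -> 'cV[F]_N.+1
}.

Definition eval_forms (F : fieldType) (N : nat)
    (f : 'I_N.+1 -> {mpoly F[N.+1]}) (x : 'cV[F]_N.+1) : 'cV[F]_N.+1 :=
  \col_i (f i).@[fun j => x j 0].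

(* Base change along a field morphism; for an automorphism this is the Galois
   action on coordinates. *)
Definition map_coords (F E : fieldType) (j : {rmorphism F -> E}) (N : nat)
    (V : finType) (x : coords F N V) : coords E N V :=
  Coords (fun i => map_mpoly j (forms x i)) (fun v => map_mx j (pts x v)).

(* [f] represents an element of End_d^N(F), for a field F embedded by [j] in
   an algebraically closed field E: the forms have no common zero in P^N(E),
   not merely none in P^N(F). *)
Definition is_endomorphism (F : fieldType) (E : closedFieldType)
    (j : {rmorphism F -> E}) (N d : nat)
    (f : 'I_N.+1 -> {mpoly F[N.+1]}) : Prop :=
  (forall i, f i \is d.-homog) /\
  (forall x : 'cV[E]_N.+1, x != 0 ->
     eval_forms (fun i => map_mpoly j (f i)) x != 0).

(* [x] represents an element of End_d^N[P](F), F being embedded in E by j. *)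
Definition is_EndP_point (F : fieldType) (E : closedFieldType)
    (j : {rmorphism F -> E}) (N d : nat) (P : portrait)
    (x : coords F N (vert P)) : Prop :=
  [/\ is_endomorphism j d (forms x),
      forall v, pts x v != 0,
      forall v w, v != w -> ~ proj_eq (pts x v) (pts x w)
    & forall v : {v : vert P | v \in dom P},
        proj_eq (eval_forms (forms x) (pts x (val v)))
                (pts x (portrait_map v))].

(* A^-1 o f o A, where A acts on column vectors by x |-> A *m x. *)
Definition conj_forms (F : fieldType) (N : nat) (A : 'M[F]_N.+1)
    (f : 'I_N.+1 -> {mpoly F[N.+1]}) : 'I_N.+1 -> {mpoly F[N.+1]} :=
  fun i => \sum_k invmx A i k *:
    (f k \mPo [tuple \sum_l A m l *: 'X_l | m < N.+1]).

Definition conj_coords (F : fieldType) (N : nat) (V : finType)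
    (A : 'M[F]_N.+1) (x : coords F N V) : coords F N V :=
  Coords (conj_forms A (forms x)) (fun v => invmx A *m pts x v).

(* Equality of points of End_d^N x (P^N)^V given by homogeneous coordinates. *)
Definition coords_eq (F : fieldType) (N : nat) (V : finType)
    (x y : coords F N V) : Prop :=
  (exists2 c : F, c != 0 & forall i, forms y i = c *: forms x i) /\
  (forall v, proj_eq (pts x v) (pts y v)).

(* Over an algebraically closed field E, the points of M_d^N[P](E) are the
   PGL_{N+1}(E)-orbits in End_d^N[P](E): two points of End_d^N[P](E) have the
   same image in M_d^N[P](E) when they are related by [moduli_eq]. *)
Definition moduli_eq (E : closedFieldType) (N : nat) (V : finType)
    (x y : coords E N V) : Prop :=
  exists2 A : 'M[E]_N.+1, A \in unitmx & coords_eq (conj_coords A x) y.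

Definition is_algebraic_closure (K : fieldType) (Kbar : closedFieldType)
    (iota : {rmorphism K -> Kbar}) : Prop :=
  forall a : Kbar, algebraicOver iota a.

Definition in_Gal (K : fieldType) (Kbar : closedFieldType)
    (iota : {rmorphism K -> Kbar}) (s : {rmorphism Kbar -> Kbar}) : Prop :=
  bijective s /\ (forall a : K, s (iota a) = iota a).

(* The image xi of [x] in M_d^N[P](Kbar) lies in M_d^N[P](K), i.e. the field
   of moduli of xi is contained in K.  As K is perfect, the K-points of the
   variety M_d^N[P] are its Kbar-points fixed by Gal(Kbar/K). *)
Definition field_of_moduli_in (K : fieldType) (Kbar : closedFieldType)
    (iota : {rmorphism K -> Kbar}) (N : nat) (V : finType)
    (x : coords Kbar N V) : Prop :=
  forall s : {rmorphism Kbar -> Kbar}, in_Gal iota s ->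
    moduli_eq (map_coords s x) x.

(* L, embedded in Kbar by j, is a field of definition for the image of [x] in
   M_d^N[P](Kbar). *)
Definition field_of_definition (L : fieldType) (Kbar : closedFieldType)
    (j : {rmorphism L -> Kbar}) (N d : nat) (P : portrait)
    (x : coords Kbar N (vert P)) : Prop :=
  exists2 y : coords L N (vert P),
    is_EndP_point j d y & moduli_eq (map_coords j y) x.

(* Main.v *)
Require Import Defs.
From HB Require Import structures.
From mathcomp Require Import all_boot all_order all_algebra all_field.
From mathcomp Require Import mpoly.
From mathcomp Require Import perm ring.
From mathcomp Require boolp classical_sets.

(* Let f be the endomorphism underlying xi, and k the algebraic closure of K.
   The map A |-> adj(A) o f o A from n x n matrices (n = N + 1) to n-tuples of
   forms of degree d has injective differential at the identity, so some n^2
   of its coordinates, taken to be values of components at integral points,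
   give a dominant map c from k^(n^2) to itself, polynomial of degree at most
   N + d.  By dominance the equation c(A) = q has an invertible solution A0 for
   general q in Q^(n^2), and by Perron's bound on algebraic relations it has
   at most s^(n^2) solutions with s = s(N, d).  As q is rational, this finite
   set is intrinsic: if the class of x = (f, (P_v)) is fixed by the Galois
   group, then the conjugates of the representative of x obtained from A0 are
   the representatives obtained from other solutions.  The representative thus
   has at most s^(n^2) conjugates over K, whatever the portrait.

   Injectivity of the differential: if Df(z) C z = C f(z) identically, then f
   maps eigenvectors of C for a to eigenvectors for d a, so C is nilpotent, and
   comparing degrees in t in f(exp(t C) z) = exp(t C) f(z) gives C = 0. *)

Set Implicit Arguments.
Unset Strict Implicit.
Unset Printing Implicit Defensive.

Import GRing.Theory.
Local Open Scope ring_scope.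

(** * Polynomials on lines, grids and arcs *)

Section LinePolynomials.

Variables (k : fieldType) (V : lmodType k).
Implicit Types (phi : V -> k) (e : nat).

(** Bounding the degree on every line, instead of exhibiting a polynomial in coordinates, lets
    functions of matrices be treated without vectorizing them. *)
Definition line_poly e phi := forall z w : V,
  exists2 p : {poly k}, (size p <= e.+1)%N & forall t, phi (z + t *: w) = p.[t].

Lemma line_poly_ext e phi psi : phi =1 psi -> line_poly e phi -> line_poly e psi.
Proof. by move=> eq_pp pphi z w; have [p sp hp] := pphi z w; exists p => // t; rewrite -eq_pp. Qed.

Lemma line_poly_mono e e' phi : (e <= e')%N -> line_poly e phi -> line_poly e' phi.
Proof.
by move=> ee' pphi z w; have [p sp hp] := pphi z w; exists p => //; apply: leq_trans sp _.
Qed.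

Lemma line_polyC e (c : k) : line_poly e (fun=> c).
Proof.
move=> z w; exists c%:P; last by move=> t; rewrite hornerC.
by rewrite (leq_trans (size_polyC_leq1 _)).
Qed.

Lemma line_polyD e phi psi :
  line_poly e phi -> line_poly e psi -> line_poly e (fun z => phi z + psi z).
Proof.
move=> h1 h2 z w; have [p sp hp] := h1 z w; have [q sq hq] := h2 z w.
exists (p + q); last by move=> t; rewrite hp hq hornerD.
by rewrite (leq_trans (size_polyD _ _)) // geq_max sp.
Qed.

Lemma line_polyM e e' phi psi :
  line_poly e phi -> line_poly e' psi -> line_poly (e + e') (fun z => phi z * psi z).
Proof.
move=> h1 h2 z w; have [p sp hp] := h1 z w; have [q sq hq] := h2 z w.
exists (p * q); last by move=> t; rewrite hp hq hornerM.
have [->|p0] := eqVneq p 0; first by rewrite mul0r size_poly0.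
have [->|q0] := eqVneq q 0; first by rewrite mulr0 size_poly0.
by rewrite size_mul // -subn1 leq_subLR add1n -addnS -addSn leq_add.
Qed.

Lemma line_polyZ e (c : k) phi : line_poly e phi -> line_poly e (fun z => c * phi z).
Proof. by move=> h; apply: (@line_polyM 0 e); first exact: line_polyC. Qed.

Lemma line_poly_sum (I : Type) (r : seq I) (P : pred I) e (F : I -> V -> k) :
  (forall i, P i -> line_poly e (F i)) ->
  line_poly e (fun z => \sum_(i <- r | P i) F i z).
Proof.
move=> hF; elim: r => [|i r IHr].
  by apply: line_poly_ext (line_polyC e 0) => z; rewrite big_nil.
case Pi: (P i); last by apply: line_poly_ext IHr => z; rewrite big_cons Pi.
apply: line_poly_ext (line_polyD (hF i Pi) IHr) => z.
by rewrite big_cons Pi.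
Qed.

Lemma line_poly_prod (I : Type) (r : seq I) (e : I -> nat) (F : I -> V -> k) :
  (forall i, line_poly (e i) (F i)) ->
  line_poly (\sum_(i <- r) e i) (fun z => \prod_(i <- r) F i z).
Proof.
move=> hF; elim: r => [|i r IHr].
  by rewrite big_nil; apply: line_poly_ext (line_polyC 0 1) => z; rewrite big_nil.
rewrite big_cons; apply: line_poly_ext (line_polyM (hF i) IHr) => z.
by rewrite big_cons.
Qed.

Lemma line_polyX e m phi : line_poly e phi -> line_poly (m * e) (fun z => phi z ^+ m).
Proof.
move=> h; elim: m => [|m IHm]; first by apply: line_poly_ext (line_polyC 0 1).
by apply: line_poly_ext (line_polyM h IHm) => z; rewrite exprS.
Qed.

Lemma line_poly_meval n (h : 'I_n -> V -> k) (p : {mpoly k[n]}) e :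
  (forall i, line_poly 1 (h i)) -> (msize p <= e.+1)%N ->
  line_poly e (fun z => p.@[fun i => h i z]).
Proof.
move=> hh sp.
apply: line_poly_ext
  (_ : line_poly e (fun z => \sum_(m <- msupp p | m \in msupp p)
                        p@_m * \prod_i h i z ^+ m i)) => [z|].
  by rewrite mevalE [RHS]big_seq.
apply: line_poly_sum => m /msize_mdeg_lt mp; apply: line_polyZ.
apply: line_poly_mono (_ : (\sum_(i < n) m i <= e)%N) _.
  by rewrite -mdegE -ltnS (leq_trans mp).
apply: line_poly_prod => i; rewrite -[X in line_poly X]muln1.
exact: line_polyX.
Qed.

End LinePolynomials.

Lemma line_poly_entry (k : fieldType) m n (i : 'I_m) (j : 'I_n) :
  line_poly 1 (fun A : 'M[k]_(m, n) => A i j).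
Proof.
move=> A B; exists ((A i j)%:P + B i j *: 'X).
  rewrite (leq_trans (size_polyD _ _)) // geq_max.
  rewrite (leq_trans (size_polyC_leq1 _)) //=.
  by rewrite (leq_trans (size_scale_leq _ _)) // size_polyX.
by move=> t; rewrite !mxE !hornerE mulrC.
Qed.

Section CharZero.

Variables (k : fieldType) (ch0 : [pchar k] =i pred0).

Lemma natr_inj_char0 : injective (fun n : nat => n%:R : k).
Proof.
have h0 := (pcharf0P k).1 ch0.
move=> m n /eqP; wlog: m n / (m <= n)%N => [hw|le_mn].
  by case/orP: (leq_total m n) => le e; [|apply/esym]; apply: hw; rewrite // eq_sym.
rewrite eq_sym -subr_eq0 -natrB // h0 subn_eq0 => le_nm.
by apply/eqP; rewrite eqn_leq le_mn.
Qed.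

Lemma poly_eq0_nat (p : {poly k}) e : (size p <= e.+1)%N ->
  (forall i, (i <= e)%N -> p.[i%:R] = 0) -> p = 0.
Proof.
move=> sp hp; apply/eqP; apply/negPn/negP => p0.
pose rs := [seq i%:R | i <- iota 0 e.+1] : seq k.
have rs_root : all (root p) rs.
  by apply/allP => x /mapP[i]; rewrite mem_iota add0n ltnS => /hp pi ->; apply/rootP.
have rs_uniq : uniq rs by rewrite map_inj_uniq ?iota_uniq //; apply: natr_inj_char0.
by have := max_poly_roots p0 rs_root rs_uniq; rewrite size_map size_iota ltnNge sp.
Qed.

Lemma poly_eq0_fun (p : {poly k}) : (forall t, p.[t] = 0) -> p = 0.
Proof. by move=> hp; apply: (@poly_eq0_nat p (size p)). Qed.

Lemma poly_ext (p q : {poly k}) : (forall t, p.[t] = q.[t]) -> p = q.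
Proof.
by move=> pq; apply/subr0_eq/poly_eq0_fun => t; rewrite hornerD hornerN pq subrr.
Qed.

(** The entries leave the grid one at a time: in each of them the function is a polynomial of degree
    at most [e] with the [e.+1] roots 0, ..., e. *)
Lemma line_poly_grid_eq0 m n e (phi : 'M[k]_(m, n) -> k) : line_poly e phi ->
  (forall a : 'M['I_e.+1]_(m, n), phi (map_mx (fun i : 'I_e.+1 => i%:R) a) = 0) ->
  forall z, phi z = 0.
Proof.
move=> pphi h0.
(* [s] lists the entries of [z] that may lie off the grid. *)
suff gen (s : seq ('I_m * 'I_n)) (z : 'M[k]_(m, n)) :
    (forall i j, (i, j) \notin s -> exists2 a, (a <= e)%N & z i j = a%:R) -> phi z = 0.
  move=> z; apply: (gen (enum {: 'I_m * 'I_n})) => i j.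
  by rewrite mem_enum.
elim: s z => [|[i j] s IHs] z hz.
  have /fin_all_exists[a ha] (ij : 'I_m * 'I_n) : exists a : 'I_e.+1, z ij.1 ij.2 = a%:R.
    by have [//|a ae ->] := hz ij.1 ij.2; exists (inord a); rewrite inordK.
  rewrite -(h0 (\matrix_(i, j) a (i, j))); congr phi; apply/matrixP => i j.
  by rewrite !mxE -ha.
have [p sp hp] := pphi (z - z i j *: delta_mx i j) (delta_mx i j).
suff p0 : p = 0 by have := hp (z i j); rewrite subrK p0 horner0.
apply: poly_eq0_nat sp _ => a ae; rewrite -hp; apply: IHs => i' j' ijs.
rewrite !mxE; have [ij_eq|ij_neq] := boolP ((i', j') == (i, j)).
  by case/eqP: ij_eq => -> ->; rewrite !eqxx !mulr1 subrr add0r; exists a.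
rewrite -[_ && _]/((i', j') == (i, j)) (negPf ij_neq) !mulr0 subr0 addr0.
by apply: hz; rewrite inE (negPf ij_neq).
Qed.

(** Digits in base [B] are read off one after the other modulo [B]; taking functions on [nat] makes
    the shift in the induction painless. *)
Lemma base_expansion_inj n B (f g : nat -> nat) :
  (forall i, (i < n)%N -> (f i < B)%N /\ (g i < B)%N) ->
  (\sum_(i < n) f i * B ^ i = \sum_(i < n) g i * B ^ i)%N ->
  forall i, (i < n)%N -> f i = g i.
Proof.
elim: n f g => [//|n IHn] f g fgB.
rewrite !big_ord_recl /= !expn0 !muln1.
have shift (u : nat -> nat) :
    (\sum_(i < n) u (bump 0 i) * B ^ bump 0 i = (\sum_(i < n) u i.+1 * B ^ i) * B)%N.
  by rewrite big_distrl; apply: eq_bigr => i _; rewrite expnSr mulnA.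
have [f0 g0] := fgB 0%N isT.
rewrite !shift => eq_fg.
have e0 : f 0%N = g 0%N.
  by have := congr1 (modn^~ B) eq_fg; rewrite ![(_ + _ * B)%N]addnC !modnMDl !modn_small.
move: eq_fg; rewrite e0 => /addnI/eqP; rewrite eqn_pmul2r ?(leq_ltn_trans _ f0) //.
move=> /eqP eqs [//|i] ltin.
by apply: (IHn (fun i => f i.+1) (fun i => g i.+1)) => // j jn; apply: fgB.
Qed.

(* Kronecker's substitution x_i = t ^ (B ^ i), with B above all exponents,
   separates the monomials. *)
Lemma mpoly_nat_neq0 n (p : {mpoly k[n]}) : p != 0 ->
  exists z : 'I_n -> nat, p.@[fun i => (z i)%:R] != 0.
Proof.
move=> p0; pose B := msize p.
pose wt (m : 'X_{1..n}) := (\sum_i m i * B ^ i)%N.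
pose P := \sum_(m <- msupp p) p@_m *: 'X^(wt m) : {poly k}.
have wt_inj m m' : m \in msupp p -> m' \in msupp p -> wt m = wt m' -> m = m'.
  pose f (u : 'X_{1..n}) (j : nat) := oapp u 0%N (insub j : option 'I_n).
  have fE u (i : 'I_n) : f u i = u i by rewrite /f valK.
  have lt_B u (j : 'I_n) : u \in msupp p -> (u j < B)%N.
    by move=> /msize_mdeg_lt lt_u; apply: leq_ltn_trans lt_u; rewrite mdegE (bigD1 j) //= leq_addr.
  move=> pm pm' e; apply/mnmP => i; rewrite -!fE.
  apply: (@base_expansion_inj n B (f m) (f m') _ _ i (ltn_ord i)).
    by move=> j jn; rewrite -[j]/(val (Ordinal jn)) !fE !lt_B.
  by under eq_bigr do rewrite fE; under [RHS]eq_bigr do rewrite fE.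
have P0 : P != 0.
  apply/eqP => /(congr1 (fun q : {poly k} => q`_(wt (mlead p)))).
  have lp := mlead_supp p0.
  rewrite coef0 coef_sum (bigD1_seq (mlead p)) ?msupp_uniq //= coefZ coefXn eqxx mulr1.
  rewrite big_seq_cond big1 ?addr0 => [/eqP|m /andP[mp neq]].
    by rewrite mleadc_eq0 (negPf p0).
  rewrite coefZ coefXn; case: eqP => [/esym/wt_inj e|]; last by rewrite mulr0.
  by rewrite e // eqxx in neq.
have [t Pt] : exists t : nat, P.[t%:R] != 0.
  have [/existsP[i Pi]|/existsPn noroot] := boolP [exists i : 'I_(size P).+1, P.[i%:R] != 0].
    by exists i.
  case/eqP: P0; apply: (@poly_eq0_nat P (size P)) => // i ile.
  by have := noroot (inord i); rewrite inordK // negbK => /eqP.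
exists (fun i => (t ^ (B ^ i))%N).
suff -> : p.@[fun i => (t ^ (B ^ i))%:R] = P.[t%:R] by [].
rewrite mevalE horner_sum; apply: eq_bigr => m _; rewrite hornerZ hornerXn; congr (_ * _).
rewrite /wt expr_sum; apply: eq_bigr => i _.
by rewrite natrX -exprM mulnC.
Qed.

End CharZero.

(** * Derivatives of polynomials along polynomial curves *)

Section ChainRule.

Variables (k : comNzRingType) (n : nat).

Lemma horner_mmap (h : 'I_n -> {poly k}) (p : {mpoly k[n]}) t :
  (mmap polyC h p).[t] = p.@[fun i => (h i).[t]].
Proof.
rewrite mevalE /mmap horner_sum; apply: eq_bigr => m _.
rewrite hornerM hornerC /mmap1 horner_prod; congr (_ * _).
by apply: eq_bigr => i _; rewrite horner_exp.
Qed.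

(** Both sides are derivations along [mmap polyC h], so agreement on the variables suffices. *)
Lemma deriv_mmap (h : 'I_n -> {poly k}) (p : {mpoly k[n]}) :
  (mmap polyC h p)^`() = \sum_i mmap polyC h p^`M(i) * (h i)^`().
Proof.
pose D p := \sum_i mmap polyC h p^`M(i) * (h i)^`().
have DX (i : 'I_n) : (mmap polyC h 'X_i)^`() = D 'X_i.
  rewrite mmapX mmap1U /D (bigD1 i) //= big1 ?addr0 => [|j ji].
    have -> : mderiv i 'X_i = 1 :> {mpoly k[n]}.
      rewrite mderivX mnm1E eqxx scale1r -mpolyX0; congr 'X_[_].
      by apply/mnmP => j; rewrite !mnmE subnn.
    by rewrite rmorph1 mul1r.
  by rewrite mderivX mnm1E eq_sym (negPf ji) scale0r mmap0 mul0r.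
have DM p1 p2 : (mmap polyC h p1)^`() = D p1 -> (mmap polyC h p2)^`() = D p2 ->
    (mmap polyC h (p1 * p2))^`() = D (p1 * p2).
  move=> e1 e2; rewrite rmorphM derivM e1 e2 /D mulr_suml mulr_sumr -big_split.
  apply: eq_bigr => i _ /=; rewrite mderivM mmapD !rmorphM /= mulrDl; congr (_ + _).
    by rewrite mulrAC.
  by rewrite mulrA.
have D1 : (mmap polyC h 1)^`() = D 1.
  rewrite -mpolyC1 mmapC derivC /D big1 // => i _.
  by rewrite mderivC mmap0 mul0r.
have DXn m : (mmap polyC h 'X_[m])^`() = D 'X_[m].
  rewrite mpolyXE_id; elim/big_rec: _ => // i q _ IHq; apply: (DM) => // {q IHq}.
  by elim: (m i) => // j IHj; rewrite exprS; apply: DM.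
rewrite -/(D p); elim/mpolyind: p => [|c m p _ _ IHp].
  by rewrite mmap0 deriv0 /D big1 // => i _; rewrite mderiv0 mmap0 mul0r.
rewrite mmapD derivD IHp mmapZ mul_polyC derivZ DXn /D scaler_sumr -big_split.
apply: eq_bigr => i _ /=; rewrite mderivD mderivZ mmapD mmapZ mulrDl mul_polyC.
by rewrite scalerAl.
Qed.

(** Lets a Jacobian be read off from linear coefficients along lines. *)
Lemma coef1_mmap_line (a w : 'I_n -> k) (p : {mpoly k[n]}) :
  (mmap polyC (fun j => (a j)%:P + w j *: 'X) p)`_1 = \sum_j p^`M(j).@[a] * w j.
Proof.
rewrite -[LHS]mulr1n -coef_deriv -horner_coef0 deriv_mmap horner_sum.
apply: eq_bigr => j _.
rewrite hornerM horner_mmap derivD derivC derivZ derivX add0r alg_polyC hornerC.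
by congr (_ * _); apply: meval_eq => l; rewrite !hornerE.
Qed.

End ChainRule.

(** * Dominance and algebraic relations *)

Section Constructible.

Variable k : closedFieldType.

(** The offset [o] leaves room for other variables: below, the first [n] variables are the
    coordinates of the target, and those from [n] on are the coordinates of the source. *)
Definition mpoly_term n (o : nat) (p : {mpoly k[n]}) : GRing.term k :=
  \big[@GRing.Add k/GRing.Const 0]_(m <- msupp p)
    GRing.Mul (GRing.Const p@_m)
      (\big[@GRing.Mul k/GRing.Const 1]_(i < n) GRing.Exp (GRing.Var _ (o + i)) (m i)).

Lemma eval_mpoly_term n o (p : {mpoly k[n]}) e :
  GRing.eval e (mpoly_term o p) = p.@[fun i => e`_(o + i)].
Proof.
rewrite /mpoly_term (big_morph (GRing.eval e) (id1 := 0) (op1 := +%R)) //= mevalE.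
apply: eq_bigr => m _; congr (_ * _).
by rewrite (big_morph (GRing.eval e) (id1 := 1) (op1 := *%R)).
Qed.

Lemma rterm_mpoly_term n o (p : {mpoly k[n]}) : GRing.rterm (mpoly_term o p).
Proof.
rewrite /mpoly_term; elim/big_rec: _ => //= m t _ ->; rewrite andbT.
by elim/big_rec: _ => //= i t' _ ->.
Qed.

(** The value 0 at inverses is a dummy, as only terms satisfying [rterm] are evaluated. Variables
    from [n] on go to 0, in accordance with the default value of [nth]. *)
Fixpoint term_mpoly n (t : GRing.term k) : {mpoly k[n]} :=
  match t with
  | GRing.Var i => oapp (fun j => 'X_j) 0 (insub i)
  | GRing.Const c => c%:MP
  | GRing.NatConst m => m%:R
  | GRing.Add t1 t2 => term_mpoly n t1 + term_mpoly n t2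
  | GRing.Opp t1 => - term_mpoly n t1
  | GRing.NatMul t1 m => term_mpoly n t1 *+ m
  | GRing.Mul t1 t2 => term_mpoly n t1 * term_mpoly n t2
  | GRing.Inv t1 => 0
  | GRing.Exp t1 m => term_mpoly n t1 ^+ m
  end.

Lemma meval_term_mpoly n (e : seq k) t : GRing.rterm t -> size e = n ->
  (term_mpoly n t).@[fun i => e`_i] = GRing.eval e t.
Proof.
move=> rt se; elim: t rt => //=.
- move=> i _; case: insubP => [j _ <-|] /=; first by rewrite mevalXU.
  by rewrite -leqNgt => le_ni; rewrite meval0 nth_default ?se.
- by move=> c _; rewrite mevalC.
- by move=> m _; rewrite rmorph_nat.
- by move=> t1 IH1 t2 IH2 /andP[r1 r2]; rewrite mevalD IH1 ?IH2.
- by move=> t1 IH1 r1; rewrite mevalN IH1.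
- by move=> t1 IH1 m r1; rewrite mevalMn IH1.
- by move=> t1 IH1 t2 IH2 /andP[r1 r2]; rewrite mevalM IH1 ?IH2.
- by move=> t1 IH1 m r1; rewrite rmorphXn /= IH1.
Qed.

(** Each atom is a polynomial equation, which holds everywhere or fails off a hypersurface; [h] is a
    product of the nonzero differences. *)
Lemma qf_eval_generic n (f : GRing.formula k) :
  GRing.qf_form f && GRing.rformula f ->
  exists2 h : {mpoly k[n]}, h != 0 & exists b, forall e : seq k,
    size e = n -> h.@[fun i => e`_i] != 0 -> GRing.qf_eval e f = b.
Proof.
have comb (f1 f2 : GRing.formula k) (op : bool -> bool -> bool) :
    (exists2 h : {mpoly k[n]}, h != 0 & exists b, forall e : seq k,
       size e = n -> h.@[fun i => e`_i] != 0 -> GRing.qf_eval e f1 = b) ->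
    (exists2 h : {mpoly k[n]}, h != 0 & exists b, forall e : seq k,
       size e = n -> h.@[fun i => e`_i] != 0 -> GRing.qf_eval e f2 = b) ->
    exists2 h : {mpoly k[n]}, h != 0 & exists b, forall e : seq k,
      size e = n -> h.@[fun i => e`_i] != 0 ->
      op (GRing.qf_eval e f1) (GRing.qf_eval e f2) = b.
  move=> [h1 h1n0 [b1 hb1]] [h2 h2n0 [b2 hb2]]; exists (h1 * h2); first by rewrite mulf_neq0.
  exists (op b1 b2) => e se; rewrite mevalM mulf_eq0 negb_or => /andP[e1 e2].
  by rewrite hb1 ?hb2.
elim: f => //=.
- by move=> b _; exists 1; rewrite ?oner_eq0 //; exists b.
- move=> t1 t2 /andP[r1 r2].
  have [eq_t|neq_t] := eqVneq (term_mpoly n t1) (term_mpoly n t2).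
    exists 1; rewrite ?oner_eq0 //; exists true => e se _.
    by rewrite -!(meval_term_mpoly _ se) // eq_t eqxx.
  exists (term_mpoly n t1 - term_mpoly n t2); first by rewrite subr_eq0.
  exists false => e se; rewrite mevalB !meval_term_mpoly // subr_eq0 => /negPf //.
- move=> f1 IH1 f2 IH2 h; apply: comb; [apply: IH1|apply: IH2];
  by case/andP: h => /andP[q1 q2] /andP[r1 r2]; apply/andP.
- move=> f1 IH1 f2 IH2 h; apply: comb; [apply: IH1|apply: IH2];
  by case/andP: h => /andP[q1 q2] /andP[r1 r2]; apply/andP.
- move=> f1 IH1 f2 IH2 h; apply: (comb _ _ implb); [apply: IH1|apply: IH2];
  by case/andP: h => /andP[q1 q2] /andP[r1 r2]; apply/andP.
- move=> f1 IH1 /IH1[h h0 [b hb]]; exists h => //; exists (~~ b) => e se he.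
  by rewrite hb.
Qed.

(* By quantifier elimination the image is constructible, so either it or its
   complement contains a nonempty open set. *)
Lemma dominant_image_generic m n (c : 'I_n -> {mpoly k[m]}) (g : {mpoly k[m]}) :
  (forall F : {mpoly k[n]},
     (forall a, g.@[a] != 0 -> F.@[fun i => (c i).@[a]] = 0) -> F = 0) ->
  exists2 h : {mpoly k[n]}, h != 0 &
    forall y, h.@[y] != 0 -> exists2 a, g.@[a] != 0 & forall i, (c i).@[a] = y i.
Proof.
move=> dom.
pose body : GRing.formula k :=
  GRing.And (GRing.Not (GRing.Equal (mpoly_term n g) (GRing.Const 0)))
    (\big[@GRing.And k/GRing.Bool true]_(i < n)
       GRing.Equal (mpoly_term n (c i)) (GRing.Var _ i)).
pose f := foldr (@GRing.Exists k) body (iota n m).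
have rbody : GRing.rformula body.
  rewrite /= rterm_mpoly_term /=.
  by elim/big_rec: _ => //= i t _ ->; rewrite rterm_mpoly_term.
have rf : GRing.rformula f by rewrite /f; elim: (iota n m).
have holds_body e : GRing.holds e body <->
    g.@[fun i => e`_(n + i)] != 0 /\ forall i, (c i).@[fun i => e`_(n + i)] = e`_i.
  rewrite /= eval_mpoly_term.
  have -> : GRing.holds e (\big[@GRing.And k/GRing.Bool true]_(i < n)
       GRing.Equal (mpoly_term n (c i)) (GRing.Var _ i)) <->
      forall i : 'I_n, (c i).@[fun i => e`_(n + i)] = e`_i.
    rewrite -[X in _ <-> X]/(forall i : 'I_n, _).
    suff gen (r : seq 'I_n) : GRing.holds e (\big[@GRing.And k/GRing.Bool true]_(i <- r)
         GRing.Equal (mpoly_term n (c i)) (GRing.Var _ i)) <->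
        forall i : 'I_n, i \in r -> (c i).@[fun i => e`_(n + i)] = e`_i.
      by rewrite gen; split=> h i; [apply: h; rewrite mem_index_enum|move=> _; apply: h].
    elim: r => [|i r IHr]; first by rewrite big_nil.
    rewrite big_cons /= eval_mpoly_term IHr; split=> [[h1 h2] j|h].
      by rewrite inE => /orP[/eqP ->|/h2].
    by split=> [|j jr]; apply: h; rewrite inE ?eqxx ?jr ?orbT.
  by split=> -[h1 h2]; split=> //; apply/eqP.
have holdsP (y : 'I_n -> k) : GRing.holds [tuple y i | i < n] f <->
    exists2 a, g.@[a] != 0 & forall i, (c i).@[a] = y i.
  rewrite /f -GRing.foldExistsP; split=> [[e' eq_e /holds_body[ge ce]]|[a ga ca]].
    exists (fun i => e'`_(n + i)) => // i; rewrite ce -eq_e.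
      by rewrite nth_mktuple.
    by rewrite inE /= mem_iota negb_and leqNgt ltn_ord.
  pose e' := [tuple y i | i < n] ++ [tuple a i | i < m].
  have e'l (i : 'I_n) : e'`_i = y i.
    by rewrite nth_cat size_tuple ltn_ord nth_mktuple.
  have e'r (i : 'I_m) : e'`_(n + i) = a i.
    by rewrite nth_cat size_tuple ltnNge leq_addr /= addKn nth_mktuple.
  exists e' => [i|].
    rewrite inE /= mem_iota negb_and -ltnNge -leqNgt => /orP[lt_in|le_i].
      by rewrite /e' nth_cat size_tuple lt_in.
    rewrite !nth_default ?size_cat ?size_tuple //.
    by rewrite card_ord (leq_trans _ le_i) ?leq_addr.
  apply: (holds_body _).2; have ext (p : {mpoly k[m]}) :
      p.@[fun i => e'`_(n + i)] = p.@[a] by apply: meval_eq.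
  by rewrite ext; split=> // i; rewrite ext ca e'l.
have wfp := ClosedFieldQE.wf_ex_elim (F := k).
have okp := ClosedFieldQE.holds_ex_elim (@solve_monicpoly k).
have wf := GRing.quantifier_elim_wf wfp rf.
have [h h0 [b hb]] := @qf_eval_generic n _ wf.
have genP (y : 'I_n -> k) : h.@[y] != 0 ->
    reflect (exists2 a, g.@[a] != 0 & forall i, (c i).@[a] = y i) b.
  move=> hy; rewrite -(hb [tuple y i | i < n]) ?size_tuple //.
    by case: (holdsP y) => h1 h2; apply: (iffP (GRing.quantifier_elim_rformP wfp okp _ rf)).
  rewrite (meval_eq (v2 := y)) // => i.
  by rewrite nth_mktuple.
exists h => // y hy; case: b {hb} genP => genP; first exact: elimT (genP y hy) isT.
(* If [b] is false, the image misses the locus where [h] is nonzero, so [h] vanishes on the image,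
   against dominance. *)
case/eqP: h0; apply: dom => a ga; apply/eqP/negPn/negP => ha.
suff : false by [].
by apply: introT (genP _ ha) _; exists a.
Qed.

End Constructible.

Section Independence.

Variables (k : fieldType) (ch0 : [pchar k] =i pred0).

(* The lowest homogeneous part of F at y0 vanishes at every tangent
   direction w. *)
Lemma vanishing_on_arcs_eq0 n (F : {mpoly k[n]}) (y0 : 'I_n -> k) :
  (forall w : 'I_n -> k, exists (P : 'I_n -> {poly k}) (Q : {poly k}),
     [/\ Q != 0, forall s, Q.[s] != 0 -> F.@[fun i => (P i).[s]] = 0
       & forall i, (P i)`_0 = y0 i /\ (P i)`_1 = w i]) ->
  F = 0.
Proof.
move=> arcs; apply/eqP/negPn/negP => F0.
(* Translate [y0] to the origin. *)
pose G := F \mPo [tuple 'X_i + (y0 i)%:MP | i < n].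
have GE y : G.@[y] = F.@[fun i => y i + y0 i].
  rewrite comp_mpoly_meval; apply: meval_eq => i.
  by rewrite tnth_mktuple mevalD mevalXU mevalC.
have G0 : G != 0.
  apply/eqP => G0; have [z /eqP[]] := mpoly_nat_neq0 ch0 F0.
  have := GE (fun i => (z i)%:R - y0 i); rewrite G0 meval0 => ->.
  by apply: meval_eq => i; rewrite subrK.
have exr : exists r, has (fun m => mdeg m == r) (msupp G).
  exists (mdeg (mlead G)); apply/hasP; exists (mlead G) => //; exact: mlead_supp.
case: (ex_minnP exr) => r /hasP[m0 m0G /eqP m0r] rmin {exr}.
pose H := \sum_(m <- msupp G | mdeg m == r) G@_m *: 'X_[m].
have H0 : H != 0.
  apply/eqP => /(congr1 (mcoeff m0)); rewrite mcoeff0 raddf_sum /= big_mkcond.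
  rewrite (bigD1_seq m0) ?msupp_uniq //= m0r eqxx mcoeffZ mcoeffX eqxx mulr1.
  rewrite big1 ?addr0 => [/eqP|m m_neq]; first by rewrite mcoeff_eq0 m0G.
  by case: ifP => // _; rewrite mcoeffZ mcoeffX (negPf m_neq) mulr0.
have [w Hw] := mpoly_nat_neq0 ch0 H0.
have [P [Q [Q0 FP Pw]]] := arcs (fun i => (w i)%:R).
(* The arc is y0 + X W, so that [W] takes the value [w] at 0. *)
pose W i := drop_poly 1 (P i).
have PE i s : (P i).[s] = (W i).[s] * s + y0 i.
  rewrite -{1}(poly_take_drop 1 (P i)) hornerD hornerM hornerXn expr1 addrC.
  congr (_ + _); rewrite /take_poly poly_def big_ord1 expr0 alg_polyC hornerC.
  by case: (Pw i).
have W0 i : (W i).[0] = (w i)%:R.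
  by rewrite horner_coef0 coef_drop_poly; case: (Pw i).
(* [U] is G(X W) divided by X^r, and its value at 0 is that of [H] at [w]. On the support of [G] the
   subtraction [mdeg m - r] is exact, by minimality of [r]. *)
pose U := \sum_(m <- msupp G) G@_m *: ('X^(mdeg m - r) * \prod_i W i ^+ m i).
have U0 : U = 0.
  suff : Q * ('X^r * U) = 0.
    by move=> /eqP; rewrite !mulf_eq0 (negPf Q0) -size_poly_eq0 size_polyXn => /eqP.
  apply: (poly_eq0_fun ch0) => s; rewrite !hornerM.
  have [->|Qs] := eqVneq Q.[s] 0; first by rewrite mul0r.
  suff -> : 'X^r.[s] * U.[s] = G.@[fun i => (W i).[s] * s].
    rewrite GE -[RHS](mulr0 Q.[s]); congr (_ * _); rewrite -(FP s Qs).
    by apply: meval_eq => i; rewrite PE.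
  rewrite hornerXn mevalE horner_sum mulr_sumr big_seq [RHS]big_seq.
  apply: eq_bigr => m mG; rewrite hornerZ hornerM hornerXn mulrCA; congr (_ * _).
  rewrite mulrA -exprD subnKC; last by apply: rmin; apply/hasP; exists m.
  rewrite horner_prod mdegE -prodrXr -big_split; apply: eq_bigr => i _ /=.
  by rewrite horner_exp exprMn mulrC.
case/eqP: Hw; have := congr1 (horner^~ 0) U0; rewrite horner0 => <-.
rewrite /H /U raddf_sum horner_sum /= big_mkcond [LHS]big_seq [RHS]big_seq.
apply: eq_bigr => m mG; rewrite hornerZ hornerM hornerXn expr0n subn_eq0.
have -> : (mdeg m == r) = (mdeg m <= r)%N.
  by rewrite eqn_leq [X in _ && X]rmin ?andbT //; apply/hasP; exists m.
case: ifP => _; last by rewrite mul0r mulr0.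
rewrite mevalZ mevalX mul1r horner_prod; congr (_ * _).
by apply: eq_bigr => i _; rewrite horner_exp W0.
Qed.

End Independence.

(** Put B = (M + 1) D + 1 and s = B^M. In M + 1 polynomials of degree at most D there are (s + 1)^(M
    + 1) monomials with exponents at most s, of degree at most E = (M + 1) s D. A grid with E + 1
    values for each of M entries has at most (B (s + 1))^M = s (s + 1)^M points, which is fewer. *)
Definition perron_bound M D := ((M.+1 * D).+1 ^ M)%N.

Section Perron.

Variables (k : fieldType) (ch0 : [pchar k] =i pred0).

(* Perron's theorem: there are more monomials in the M + 1 given polynomials
   than coefficients, here values on a grid, to be killed. *)
Lemma perron_relation n1 n2 D (M := (n1 * n2)%N) (s := perron_bound M D)
    (c : 'I_M -> 'M[k]_(n1, n2) -> k) (a : 'M[k]_(n1, n2) -> k) :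
  (forall i, line_poly D (c i)) -> line_poly D a ->
  exists2 R : 'I_s.+1 -> {mpoly k[M]}, (exists e, R e != 0) &
    forall z, \sum_e (R e).@[fun i => c i z] * a z ^+ e = 0.
Proof.
move=> pc pa.
pose I : finType := ({ffun 'I_M -> 'I_s.+1} * 'I_s.+1)%type.
pose E := (M * (s * D) + s * D)%N.
pose J : finType := 'M['I_E.+1]_(n1, n2).
pose mono (x : I) z := (\prod_i c i z ^+ x.1 i) * a z ^+ x.2.
have pmono x : line_poly E (mono x).
  apply: line_polyM.
    apply: line_poly_mono (line_poly_prod (e := fun i => (x.1 i * D)%N) _ _) => [|i].
      rewrite -[X in (_ <= X * _)%N]card_ord -sum_nat_const leq_sum // => i _.
      by rewrite leq_mul2r -ltnS ltn_ord orbT.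
    exact: line_polyX.
  apply: line_poly_mono (line_polyX _ pa).
  by rewrite leq_mul2r -ltnS ltn_ord orbT.
(* A vector in the left kernel is a combination of the [mono x] that vanishes on the grid, hence
   everywhere. *)
pose A : 'M[k]_(#|I|, #|J|) :=
  \matrix_(x, y) mono (enum_val x) (map_mx (fun i : 'I_E.+1 => i%:R) (enum_val y : J)).
have ltJI : (#|J| < #|I|)%N.
  rewrite card_mx card_prod card_ffun !card_ord -/M.
  apply: (@leq_ltn_trans (s * s.+1 ^ M)); last first.
    by rewrite mulnC ltn_pmul2l // expn_gt0.
  rewrite {2}/s /perron_bound -expnMn; case: (posnP M) => [->//|M0].
  rewrite leq_exp2r // /E -mulSnr mulnA mulnAC mulSn mulnS.
  by rewrite addSn ltnS addnA leq_addl.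
have : kermx A != 0.
  rewrite kermx_eq0 /row_free neq_ltn; apply/orP; left.
  exact: leq_ltn_trans (rank_leq_col _) ltJI.
case/rowV0Pn => u /sub_kermxP uA u0.
pose mon (x : {ffun 'I_M -> 'I_s.+1}) : 'X_{1..M} := [multinom (x i : nat) | i < M].
have mon_inj : injective mon.
  by move=> x y /mnmP e; apply/ffunP => i; apply/val_inj; have := e i; rewrite !mnmE.
pose R (e : 'I_s.+1) := \sum_x u 0 (enum_rank ((x, e) : I)) *: 'X_[mon x] : {mpoly k[M]}.
exists R.
  have [j uj] : exists j, u 0 j != 0 by apply/rV0Pn.
  exists (enum_val j).2; apply/eqP => /(congr1 (mcoeff (mon (enum_val j).1))).
  rewrite mcoeff0 raddf_sum (bigD1 (enum_val j).1) //= mcoeffZ mcoeffX eqxx mulr1.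
  rewrite -surjective_pairing enum_valK big1 ?addr0 => [/eqP|x xj]; first exact/negP.
  by rewrite mcoeffZ mcoeffX (inj_eq mon_inj) (negPf xj) mulr0.
pose phi z := \sum_(x : I) u 0 (enum_rank x) * mono x z.
have phiE z : \sum_e (R e).@[fun i => c i z] * a z ^+ e = phi z.
  rewrite /phi; under eq_bigr => e _ do rewrite raddf_sum mulr_suml.
  rewrite exchange_big pair_bigA /=; apply: eq_bigr => -[x e] _ /=.
  rewrite mevalZ mevalX -mulrA; congr (_ * (_ * _)).
  by apply: eq_bigr => i _; rewrite mnmE.
move=> z; rewrite phiE; apply: (@line_poly_grid_eq0 _ ch0 _ _ E phi) => [|y].
  by apply: line_poly_sum => x _; apply: line_polyZ.
have := congr1 (fun v : 'rV_ _ => v 0 (enum_rank (y : J))) uA; rewrite !mxE => e0; apply: etrans e0.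
rewrite /phi (reindex (@enum_val I xpredT)); last first.
  by apply: onW_bij; apply: enum_val_bij.
by apply: eq_bigr => i _; rewrite enum_valK mxE enum_rankK.
Qed.

End Perron.

(** * Infinitesimal stabilizers of endomorphisms *)

Lemma meval_homog (k : comNzRingType) n d (p : {mpoly k[n]}) (c : k) (x : 'I_n -> k) :
  p \is d.-homog -> p.@[fun i => c * x i] = c ^+ d * p.@[x].
Proof.
move=> /dhomogP hp; rewrite !mevalE mulr_sumr big_seq [RHS]big_seq.
apply: eq_bigr => m /hp <-; rewrite mulrCA; congr (_ * _).
rewrite /= mdegE -prodrXr -big_split; apply: eq_bigr => i _ /=.
by rewrite exprMn.
Qed.

Section Stabilizer.

Variables (k : closedFieldType) (ch0 : [pchar k] =i pred0).
Variables (N d : nat) (f : 'I_N.+1 -> {mpoly k[N.+1]}).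
Hypotheses (d_gt1 : (1 < d)%N) (f_homog : forall i, f i \is d.-homog).
Hypothesis f_nz : forall x : 'cV[k]_N.+1, x != 0 -> eval_forms f x != 0.

Let natr_eq0 n : (n%:R == 0 :> k) = (n == 0%N).
Proof. by have /pcharf0P-> := ch0. Qed.

Definition diff_forms (z w : 'cV[k]_N.+1) : 'cV[k]_N.+1 :=
  \col_i \sum_j (f i)^`M(j).@[fun l => z l 0] * w j 0.

Lemma diff_formsD z w1 w2 : diff_forms z (w1 + w2) = diff_forms z w1 + diff_forms z w2.
Proof.
apply/colP => i; rewrite !mxE -big_split; apply: eq_bigr => j _.
by rewrite mxE mulrDr.
Qed.

Lemma diff_formsZ z c w : diff_forms z (c *: w) = c *: diff_forms z w.
Proof.
apply/colP => i; rewrite !mxE mulr_sumr; apply: eq_bigr => j _.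
by rewrite mxE mulrCA.
Qed.

(** Differentiate f(t z) = t^d f(z) at t = 1. *)
Lemma diff_forms_Euler z : diff_forms z z = d%:R *: eval_forms f z.
Proof.
apply/colP => i; rewrite !mxE; pose h j := z j 0 *: 'X : {poly k}.
have <- : (mmap polyC h (f i))^`().[1] = \sum_j (f i)^`M(j).@[fun l => z l 0] * z j 0.
  rewrite deriv_mmap horner_sum; apply: eq_bigr => j _.
  rewrite hornerM horner_mmap derivZ derivX alg_polyC hornerC; congr (_ * _).
  by apply: meval_eq => l; rewrite !hornerE.
have -> : mmap polyC h (f i) = (f i).@[fun l => z l 0] *: 'X^d.
  apply: (poly_ext ch0) => t; rewrite horner_mmap !hornerE mulrC -meval_homog //.
  by apply: meval_eq => l; rewrite !hornerE mulrC.
by rewrite derivZ derivXn hornerZ hornerMn hornerXn expr1n mulrC.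
Qed.

Variable C : 'M[k]_N.+1.
Hypothesis C_stab : forall z, diff_forms z (C *m z) = C *m eval_forms f z.

Lemma stabilizer_eigen x a : x != 0 -> C *m x = a *: x ->
  C *m eval_forms f x = (a * d%:R) *: eval_forms f x.
Proof. by move=> x0 Cx; rewrite -C_stab Cx diff_formsZ diff_forms_Euler scalerA. Qed.

(** A nonzero eigenvalue a would bring along all the a d^i, which are pairwise distinct as d > 1 in
    characteristic zero. The transpose is there because [eigenvalue] concerns row vectors. *)
Lemma stabilizer_root0 a : root (char_poly C^T) a -> a = 0.
Proof.
have rootP b : reflect (exists2 x : 'cV_N.+1, x != 0 & C *m x = b *: x) (root (char_poly C^T) b).
  rewrite -eigenvalue_root_char; apply: (iffP eigenvalueP) => [[v Cv v0]|[x x0 Cx]].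
    exists v^T; first by rewrite trmx_eq0.
    by apply: trmx_inj; rewrite trmx_mul trmxK Cv linearZ /= trmxK.
  exists x^T; last by rewrite trmx_eq0.
  by rewrite -trmx_mul Cx linearZ.
move=> ra; apply/eqP/negPn/negP => a0.
have rai i : root (char_poly C^T) (a * d%:R ^+ i).
  elim: i => [|i /rootP[x x0 Cx]]; first by rewrite expr0 mulr1.
  apply/rootP; exists (eval_forms f x); first exact: f_nz.
  by rewrite exprSr mulrA; apply: stabilizer_eigen.
pose p := char_poly C^T.
have p0 : p != 0 by rewrite monic_neq0 ?char_poly_monic.
pose rs := [seq a * d%:R ^+ i | i <- iota 0 (size p)].
have rs_root : all (root p) rs by apply/allP => _ /mapP[i _ ->]; apply: rai.
have rs_uniq : uniq rs.
  rewrite map_inj_uniq ?iota_uniq // => i j /(mulfI a0).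
  by rewrite -!natrX => /(natr_inj_char0 ch0)/(expnI d_gt1).
by have := max_poly_roots p0 rs_root rs_uniq; rewrite size_map size_iota ltnn.
Qed.

(** As 0 is its only root, the characteristic polynomial is a power of X, and Cayley-Hamilton
    applies. *)
Lemma stabilizer_nilpotent : C ^+ N.+1 = 0.
Proof.
have [rs def_p] := closed_field_poly_normal (char_poly C^T).
have rs0 b : b \in rs -> b = 0.
  move=> b_rs; apply: stabilizer_root0; rewrite def_p rootZ ?root_prod_XsubC //.
  by rewrite lead_coef_eq0 monic_neq0 ?char_poly_monic.
have pX : char_poly C^T = 'X^(size rs).
  rewrite def_p (monicP (char_poly_monic _)) scale1r.
  rewrite (eq_big_seq (fun=> 'X)) => [|b /rs0 ->]; last by rewrite subr0.
  by rewrite big_const_seq count_predT iter_mulr_1.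
have sz : size rs = N.+1.
  by apply/eqP; rewrite -eqSS -[X in X == _](size_polyXn k) -pX size_char_poly.
have trX m : (C ^+ m)^T = C^T ^+ m.
  elim: m => [|m IHm]; first by rewrite !expr0 trmx1.
  by rewrite exprS exprSr -IHm -[C * _]/(C *m _) trmx_mul.
by apply: trmx_inj; rewrite trmx0 -(Cayley_Hamilton C^T) pX sz rmorphXn /= horner_mx_X trX.
Qed.

(* Along the curve x_t = exp(t C) x, the vector f(x_t) solves u' = C u, hence
   has degree at most m in t, where m is the nilpotency order of C minus one;
   but its coefficient of degree d m is f(C^m x / m!), which is not zero. *)
Lemma stabilizer_trivial : C = 0.
Proof.
have exm : exists m, C ^+ m == 0 by exists N.+1; rewrite stabilizer_nilpotent.
case: (ex_minnP exm) => -[|m] /eqP Cm0 minm {exm}.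
  by move/eqP: Cm0; rewrite expr0 oner_eq0.
have [m0|m_gt0] := posnP m; first by rewrite -[C]expr1 -[1%N]/(0.+1) -{1}m0.
have Cm : C ^+ m != 0 by apply/negP => /minm; rewrite ltnn.
have C_ge i : (m < i)%N -> C ^+ i = 0.
  by move=> /subnKC <-; rewrite exprD Cm0 mul0r.
have [x Cmx] : exists x : 'cV_N.+1, C ^+ m *m x != 0.
  have /matrix0Pn[i [j Cij]] := Cm.
  exists (delta_mx j 0); rewrite -colE; apply/cV0Pn; exists i.
  by move: Cij; rewrite !mxE.
(* The coordinates of exp(t C) x, polynomial in t since C^(m + 1) = 0. *)
pose g j := \poly_(i < m.+1) ((C ^+ i *m x) j 0 / i`!%:R).
have fact0 i : i`!%:R != 0 :> k by rewrite natr_eq0 -lt0n fact_gt0.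
have Cg j : (g j)^`() = \sum_l C j l *: g l.
  apply/polyP => i; rewrite coef_deriv !coef_poly ltnS coef_sum.
  have -> : \sum_l (C j l *: g l)`_i = (if (i < m.+1)%N then (C ^+ i.+1 *m x) j 0 / i`!%:R else 0).
    case: ifP => lt_im; last by rewrite big1 // => l _; rewrite coefZ coef_poly lt_im mulr0.
    rewrite exprS -[C * _]/(C *m _) -mulmxA [(C *m _) j 0]mxE mulr_suml.
    by apply: eq_bigr => l _; rewrite coefZ coef_poly lt_im mulrA.
  case: ltngtP => [lt_im|gt_im|->].
  - rewrite ltnW // factS natrM invfM -[LHS]mulr_natr -mulrA [_ / _ * _]mulrC mulVKf //.
    by rewrite natr_eq0.
  - by rewrite ltnNge gt_im mul0rn.
  by rewrite mul0rn ltnSn C_ge // mul0mx mxE mul0r.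
pose u i := mmap polyC g (f i).
have Cu i : (u i)^`() = \sum_l C i l *: u l.
  rewrite deriv_mmap; apply: (poly_ext ch0) => s; rewrite !horner_sum.
  pose z : 'cV[k]_N.+1 := \col_j (g j).[s].
  have zE (p : {mpoly k[N.+1]}) : (mmap polyC g p).[s] = p.@[fun j => z j 0].
    by rewrite horner_mmap; apply: meval_eq => j; rewrite mxE.
  have := congr1 (fun v : 'cV_N.+1 => v i 0) (C_stab z); rewrite !mxE => e.
  apply: etrans (etrans e _); apply: eq_bigr => j _; last by rewrite hornerZ zE mxE.
  rewrite hornerM zE Cg horner_sum mxE; congr (_ * _).
  by apply: eq_bigr => l _; rewrite hornerZ mxE.
(* Iterating u' = C u gives the Taylor coefficients of u in terms of u(0). *)
have u_coef i j : (u i)`_j *+ j`! = (C ^+ j *m \col_l (u l)`_0) i 0.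
  elim: j i => [|j IHj] i; first by rewrite expr0 mul1mx mxE.
  rewrite factS mulrnA -coef_deriv Cu coef_sum -sumrMnl.
  rewrite exprS -[C * _]/(C *m _) -mulmxA mxE; apply: eq_bigr => l _.
  by rewrite coefZ -mulrnAr IHj.
have u_gt i j : (m < j)%N -> (u i)`_j = 0.
  move=> lt_mj; apply/eqP; rewrite -(mulrI_eq0 _ (mulfI (fact0 j))) mulr_natl.
  by rewrite u_coef C_ge // mul0mx mxE.
(* [h] is [g] with its coefficients reversed: h(s) = s^m g(1/s). *)
pose h j := \sum_(i < m.+1) ((C ^+ i *m x) j 0 / i`!%:R) *: 'X^(m - i).
have h_g j (s : k) : s != 0 -> (h j).[s] = s ^+ m * (g j).[s^-1].
  move=> s0; rewrite horner_sum horner_poly mulr_sumr; apply: eq_bigr => i _.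
  rewrite hornerZ hornerXn mulrCA; congr (_ * _).
  by rewrite exprVn expfB_cond // (negPf s0) /= add0n -ltnS.
(* Homogeneity transfers the reversal to [u]. The factor ['X] takes care of s = 0, where 1/s makes
   no sense. *)
have fh i : 'X * mmap polyC h (f i) = 'X * \sum_(j < m.+1) (u i)`_j *: 'X^(m * d - j).
  apply: (poly_ext ch0) => s; rewrite !hornerM !hornerX.
  have [->|s0] := eqVneq s 0; first by rewrite !mul0r.
  congr (_ * _); rewrite horner_mmap.
  transitivity ((f i).@[fun j => s ^+ m * (g j).[s^-1]]).
    by apply: meval_eq => j; apply: h_g.
  rewrite (meval_homog _ _ (f_homog i)) -exprM -horner_mmap -/(u i) (horner_coef_wide (n := m.+1)).
    rewrite horner_sum mulr_sumr; apply: eq_bigr => j _.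
    rewrite hornerZ hornerXn mulrCA; congr (_ * _).
    rewrite exprVn expfB_cond // (negPf s0) /= add0n -ltnS.
    by rewrite (leq_trans (ltn_ord j)) // ltnS leq_pmulr // ltnW.
  by apply/leq_sizeP => j; apply: u_gt.
have := @f_nz (C ^+ m *m x); rewrite Cmx => /(_ isT)/eqP[]; apply/colP => i.
have /(congr1 (horner^~ 0)) := mulfI (negbT (polyX_eq0 k)) (fh i).
(* At 0 the right-hand side vanishes, every exponent m d - j being positive: j <= m < m d. *)
rewrite horner_mmap horner_sum big1 => [|j _]; last first.
  rewrite hornerZ hornerXn expr0n subn_eq0 leqNgt (leq_trans (ltn_ord j)) ?mulr0 //.
  by rewrite -[X in (X < _)%N]muln1 ltn_pmul2l.
have h0 j : (h j).[0] = m`!%:R^-1 * (C ^+ m *m x) j 0.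
  rewrite horner_sum big_ord_recr /= subnn hornerZ hornerXn mulr1 big1 => [|l _].
    by rewrite add0r mulrC.
  by rewrite hornerZ hornerXn expr0n subn_eq0 leqNgt ltn_ord mulr0.
rewrite (meval_eq _ h0) (meval_homog _ _ (f_homog i)) => /eqP; rewrite mulf_eq0 expf_eq0 invr_eq0.
by rewrite (negPf (fact0 m)) andbF /= => /eqP; rewrite !mxE.
Qed.

End Stabilizer.

(** * Conjugation by a matrix as a polynomial map *)

Section Twist.

Variables (R : comNzRingType) (n : nat) (f : 'I_n -> {mpoly R[n]}).

(* adj(A) o f o A, which is A^-1 o f o A up to the factor det(A) but
   polynomial in A. *)
Definition twist (S : comNzRingType) (phi : {rmorphism R -> S})
    (A : 'M[S]_n) (z : 'cV[S]_n) : 'cV[S]_n :=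
  \adj A *m \col_i mmap phi (fun j => (A *m z) j 0) (f i).

Lemma rmorph_mmap (S T : comNzRingType) (phi : {rmorphism R -> S})
    (psi : {rmorphism S -> T}) (h : 'I_n -> S) (p : {mpoly R[n]}) :
  psi (mmap phi h p) = mmap (psi \o phi) (psi \o h) p.
Proof.
rewrite rmorph_sum; apply: eq_bigr => m _; rewrite rmorphM rmorph_prod.
by congr (_ * _); apply: eq_bigr => i _; rewrite rmorphXn.
Qed.

Lemma map_twist (S T : comNzRingType) (phi : {rmorphism R -> S})
    (psi : {rmorphism S -> T}) (A : 'M[S]_n) (z : 'cV[S]_n) :
  map_mx psi (twist phi A z) = twist (psi \o phi) (map_mx psi A) (map_mx psi z).
Proof.
rewrite map_mxM map_mx_adj; congr (_ *m _); apply/colP => i; rewrite !mxE rmorph_mmap.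
apply: eq_bigr => m _; congr (_ * _); apply: eq_bigr => j _.
by rewrite -map_mxM mxE.
Qed.

(** Integral points are fixed by every ring morphism, so the values of forms at them transform under
    automorphisms as the forms do. *)
Definition natvec (S : nzRingType) (z : 'I_n -> nat) : 'cV[S]_n := \col_i (z i)%:R.

(** Displays the values of [twist] at an integral point as polynomials in the entries of the
    matrix. *)
Definition generic_twist (z : 'I_n -> nat) : 'cV[{mpoly R[n * n]}]_n :=
  twist (@mpolyC (n * n) R) (\matrix_(i, j) 'X_(mxvec_index i j)) (natvec _ z).

Lemma meval_generic_twist z (a : 'rV[R]_(n * n)) i :
  (generic_twist z i 0).@[fun l => a 0 l] = twist idfun (vec_mx a) (natvec _ z) i 0.
Proof.
transitivity (map_mx (meval (fun l => a 0 l)) (generic_twist z) i 0); first by rewrite [RHS]mxE.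
rewrite map_twist.
have -> : map_mx (meval (a 0)) (\matrix_(i, j) 'X_(mxvec_index i j)) = vec_mx a.
  by apply/matrixP => i' j; rewrite !mxE mevalXU.
have -> : map_mx (meval (a 0)) (natvec _ z) = natvec _ z.
  by apply/colP => j; rewrite !mxE rmorph_nat.
rewrite !mxE; apply: eq_bigr => j _; congr (_ * _); rewrite !mxE.
by apply: eq_bigr => m _; rewrite /= mevalC.
Qed.

End Twist.

Section Jacobian.

Variables (k : closedFieldType) (ch0 : [pchar k] =i pred0).
Variables (N d : nat) (f : 'I_N.+1 -> {mpoly k[N.+1]}).
Hypotheses (d_gt1 : (1 < d)%N) (f_homog : forall i, f i \is d.-homog).
Hypothesis f_nz : forall x : 'cV[k]_N.+1, x != 0 -> eval_forms f x != 0.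

(** Its linear coefficient is the trace of [B], the differential of the determinant at the
    identity. *)
Definition det_line (B : 'M[k]_N.+1) : {poly k} :=
  \det (1%:M + 'X *: map_mx polyC B).

Lemma horner_det_line B s : (det_line B).[s] = \det (1%:M + s *: B).
Proof.
rewrite -horner_evalE -det_map_mx; congr (\det _); apply/matrixP => i j.
by rewrite !mxE rmorphD rmorphM rmorph_nat /= !horner_evalE hornerX hornerC.
Qed.

Lemma twist1 z : twist f idfun 1%:M z = eval_forms f z.
Proof.
have -> : twist f idfun 1%:M z = \adj 1%:M *m eval_forms f z.
  congr (_ *m _); apply/colP => i; rewrite !mxE.
  by apply: meval_eq => j; rewrite mul1mx.
by have := mul_mx_adj (1%:M : 'M[k]_N.+1); rewrite mul1mx det1 => ->; rewrite mul1mx.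
Qed.

Lemma mul_twist A z : A *m twist f idfun A z = \det A *: eval_forms f (A *m z).
Proof. by rewrite mulmxA mul_mx_adj mul_scalar_mx. Qed.

(** Compare linear coefficients in s in the identity [mul_twist] for A = 1 + s B; this avoids
    differentiating the adjugate. *)
Lemma twist_line_coef1 B z (P : 'I_N.+1 -> {poly k}) :
  (forall i s, (P i).[s] = twist f idfun (1%:M + s *: B) z i 0) ->
  \col_i (P i)`_1 + B *m eval_forms f z =
    (det_line B)`_1 *: eval_forms f z + diff_forms f z (B *m z).
Proof.
move=> PE; apply/colP => i.
pose F := mmap polyC (fun j => (z j 0)%:P + (B *m z) j 0 *: 'X) (f i).
have FE s : F.[s] = eval_forms f ((1%:M + s *: B) *m z) i 0.
  rewrite horner_mmap mxE; apply: meval_eq => j.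
  by rewrite mulmxDl mul1mx -scalemxAl !mxE !hornerE mulrC.
have P0 j : (P j)`_0 = eval_forms f z j 0.
  by rewrite -horner_coef0 PE scale0r addr0 twist1.
have PF : P i + 'X * \sum_j B i j *: P j = det_line B * F.
  apply: (poly_ext ch0) => s; rewrite hornerD !hornerM hornerX horner_sum FE.
  have := congr1 (fun v : 'cV_N.+1 => v i 0) (mul_twist (1%:M + s *: B) z).
  rewrite horner_det_line [in X in _ = X -> _]mxE => <-.
  rewrite mulmxDl mul1mx mxE PE; congr (_ + _).
  rewrite -scalemxAl mxE; congr (_ * _); rewrite mxE; apply: eq_bigr => j _.
  by rewrite hornerZ PE.
have := congr1 (fun p : {poly k} => p`_1) PF.
have -> : (det_line B * F)`_1 = (det_line B)`_0 * F`_1 + (det_line B)`_1 * F`_0.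
  by rewrite coefM big_ord_recr big_ord1.
rewrite coefD coefXM /= coef_sum.
have -> : (det_line B)`_0 = 1.
  by rewrite -horner_coef0 horner_det_line scale0r addr0 det1.
have -> : F`_0 = eval_forms f z i 0.
  by rewrite -horner_coef0 FE scale0r addr0 mul1mx.
rewrite coef1_mmap_line mul1r addrC => e.
rewrite !mxE; apply: etrans (etrans e _); first by rewrite addrC; congr (_ + _);
  apply: eq_bigr => j _; rewrite coefZ P0 !mxE.
by rewrite addrC !mxE.
Qed.

(** By Euler's identity, C = B + b with b = tau / (d - 1) satisfies the stabilizer equation, so B is
    the scalar matrix -b. Its trace tau is then both -b (N + 1) and b (d - 1), whence b (N + d) = 0
    and b = 0. *)
Lemma det_stabilizer_trivial B :
  (forall z, B *m eval_forms f z =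
     (det_line B)`_1 *: eval_forms f z + diff_forms f z (B *m z)) -> B = 0.
Proof.
set tau := (det_line B)`_1 => hB.
have natr0 m : (m%:R == 0 :> k) = (m == 0%N) by have /pcharf0P-> := ch0.
have d1 : d.-1%:R != 0 :> k by rewrite natr0 -lt0n -subn1 subn_gt0.
pose b := tau / d.-1%:R.
have C0 : B + b%:M = 0.
  apply: (stabilizer_trivial ch0 d_gt1 f_homog f_nz) => z.
  rewrite !mulmxDl !mul_scalar_mx diff_formsD diff_formsZ (diff_forms_Euler ch0 f_homog).
  rewrite hB addrC addrAC; congr (_ + _).
  rewrite scalerA -scalerDl; congr (_ *: _).
  have -> : (d%:R : k) = 1 + d.-1%:R by rewrite -{1}(@prednK d) ?mulrS // ltnW.
  by rewrite mulrDr mulr1 addrC /b divfK.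
have Bb : B = (- b)%:M by apply/eqP; rewrite raddfN -addr_eq0 C0.
have det_B : det_line B = (1 + - b *: 'X) ^+ N.+1.
  apply: (poly_ext ch0) => s.
  rewrite horner_det_line Bb -mul_scalar_mx -scalar_mxM -raddfD det_scalar.
  by rewrite horner_exp !hornerE mulrC.
have tauE : tau = - b * N.+1%:R.
  rewrite /tau det_B -[LHS]mulr1n -coef_deriv -horner_coef0 deriv_exp hornerMn hornerM.
  rewrite derivD derivC derivZ derivX add0r alg_polyC !hornerE expr1n.
  by rewrite mulr1 mulr_natr.
suff b0 : b = 0 by rewrite Bb b0 oppr0 raddf0.
have : tau = b * d.-1%:R by rewrite /b divfK.
rewrite tauE mulNr => /eqP; rewrite eq_sym -addr_eq0 -mulrDr -natrD mulf_eq0 natr0.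
by rewrite addnS orbF => /eqP.
Qed.

End Jacobian.

(** * A bounded fiber of the conjugation map *)

Section Slice.

Variables (k : closedFieldType) (ch0 : [pchar k] =i pred0).
Variables (N d : nat) (f : 'I_N.+1 -> {mpoly k[N.+1]}).
Hypotheses (d_gt1 : (1 < d)%N) (f_homog : forall i, f i \is d.-homog).
Hypothesis f_nz : forall x : 'cV[k]_N.+1, x != 0 -> eval_forms f x != 0.

Let M := (N.+1 * N.+1)%N.

Lemma msize_homog i : (msize (f i) <= d.+1)%N.
Proof.
have [->|fi0] := eqVneq (f i) 0; first by rewrite msize0.
have /dhomogP hf := f_homog i.
by rewrite -(mlead_deg fi0) ltnS -(hf _ (mlead_supp fi0)).
Qed.

(** The cofactors contribute degree N and f(A z) contributes d. *)
Lemma line_poly_twist z i : line_poly (N + d) (fun A => twist f idfun A z i 0).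
Proof.
apply: line_poly_ext (_ : line_poly _ (fun A : 'M[k]_N.+1 => \sum_j \adj A i j *
    (f j).@[fun l => (A *m z) l 0])) => [A|].
  by rewrite /twist [RHS]mxE; apply: eq_bigr => j _; rewrite [X in _ = _ * X]mxE.
apply: line_poly_sum => j _; apply: line_polyM.
  apply: line_poly_ext (_ : line_poly _ (fun A : 'M[k]_N.+1 => (-1) ^+ (j + i) *
      \sum_(s : 'S_N) ((-1) ^+ s * \prod_l A (lift j l) (lift i (s l))))) => [A|].
    rewrite mxE; congr (_ * _); apply: eq_bigr => s _; congr (_ * _).
    by apply: eq_bigr => l _; rewrite !mxE.
  apply: line_polyZ; apply: line_poly_sum => s _; apply: line_polyZ.
  apply: line_poly_mono (line_poly_prod (e := fun=> 1%N) _ _) => [|l].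
    by rewrite sum1_card card_ord.
  exact: line_poly_entry.
apply: line_poly_meval (msize_homog j) => l.
apply: line_poly_ext (_ : line_poly _ (fun A : 'M[k]_N.+1 => \sum_j z j 0 * A l j)) => [A|].
  by rewrite mxE; apply: eq_bigr => h _; rewrite mulrC.
by apply: line_poly_sum => h _; apply/line_polyZ/line_poly_entry.
Qed.

(** For fixed [B] the condition is polynomial in z, of degree bounded independently of [B], so a
    finite set of integral points detects it. *)
Lemma det_stabilizer_grid : exists E : nat, forall B : 'M[k]_N.+1,
  (forall z : 'cV['I_E.+1]_N.+1, let z' := map_mx (fun i : 'I_E.+1 => i%:R) z in
     B *m eval_forms f z' =
     (det_line B)`_1 *: eval_forms f z' + diff_forms f z' (B *m z')) -> B = 0.
Proof.
(* This covers the degree d of the forms and, for the term Df(z)(B z), the degree of a partial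
   derivative plus one. *)
pose E := (d + ((\max_i \max_j msize ((f i)^`M(j))) + 1))%N; exists E => B hB.
apply: (det_stabilizer_trivial ch0 d_gt1 f_homog f_nz) => z; apply/colP => i.
apply/eqP; rewrite -subr_eq0; apply/eqP.
pose phi (z : 'cV[k]_N.+1) := \sum_j B i j * (f j).@[fun l => z l 0] +
  ((- (det_line B)`_1) * (f i).@[fun l => z l 0] +
   \sum_j (f i)^`M(j).@[fun l => z l 0] * \sum_l (- B j l) * z l 0).
have phiE z' : (B *m eval_forms f z') i 0 -
    ((det_line B)`_1 *: eval_forms f z' + diff_forms f z' (B *m z')) i 0 = phi z'.
  rewrite /phi !mxE opprD mulNr -sumrN; congr (_ + (_ + _)).
    by apply: eq_bigr => j _; rewrite mxE.
  apply: eq_bigr => j _; rewrite mxE -mulrN -sumrN; congr (_ * _).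
  by apply: eq_bigr => l _; rewrite mulNr.
rewrite phiE; apply: (@line_poly_grid_eq0 _ ch0 _ _ E phi) => [|z'].
  have coord (l : 'I_N.+1) : line_poly 1 (fun z : 'cV[k]_N.+1 => z l 0).
    exact: line_poly_entry.
  have fE j : line_poly E (fun z : 'cV[k]_N.+1 => (f j).@[fun l => z l 0]).
    apply: line_poly_mono (_ : (d <= E)%N) _; first exact: leq_addr.
    by apply: line_poly_meval => //; apply: msize_homog.
  apply: line_polyD; first by apply: line_poly_sum => j _; apply: line_polyZ.
  apply: line_polyD; first exact: line_polyZ.
  apply: line_poly_sum => j _; apply: line_poly_mono (leq_addl d _) _; apply: line_polyM.
    apply: line_poly_meval => //; apply: leqW.
    by apply: leq_trans (leq_bigmax i); apply: (leq_bigmax (F := fun j => msize (f i)^`M(j))).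
  by apply: line_poly_sum => l _; apply: line_polyZ.
by rewrite -phiE hB subrr.
Qed.

(** Injectivity of the differential, tested on a finite grid, says that the Jacobian at the identity
    of all values at grid points has independent rows; M of its columns then form the invertible
    matrix [L]. *)
Lemma generic_twist_jacobian : exists (idx : 'I_M -> 'I_N.+1) (z : 'I_M -> 'I_N.+1 -> nat)
    (L : 'M[k]_M), L \in unitmx /\ forall (v : 'rV[k]_M) m, (v *m L) 0 m =
  \sum_l (generic_twist f (z m) (idx m) 0)^`M(l).@[fun l => mxvec (1%:M : 'M[k]_N.+1) 0 l] * v 0 l.
Proof.
have [E hE] := det_stabilizer_grid.
pose T : finType := ('I_N.+1 * 'cV['I_E.+1]_N.+1)%type.
pose nz (t : T) (l : 'I_N.+1) : nat := t.2 l 0.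
pose D (t : T) l := (generic_twist f (nz t) t.1 0)^`M(l).@[fun l => mxvec (1%:M : 'M[k]_N.+1) 0 l].
pose J : 'M[k]_(M, #|T|) := \matrix_(l, t) D (enum_val t) l.
have J_free : row_free J.
  rewrite -kermx_eq0; apply/negPn/negP => /rowV0Pn[v /sub_kermxP vJ /negP[]].
  have Dv t : \sum_l D t l * v 0 l = 0.
    have := congr1 (fun w : 'rV_ _ => w 0 (enum_rank t)) vJ; rewrite !mxE => e0.
    by apply: etrans e0; apply: eq_bigr => l _; rewrite mxE enum_rankK mulrC.
  (* A vector killed by [J], read as a matrix, is a direction in which no value at a grid point
     varies to first order, which is the hypothesis of [hE]. *)
  rewrite -[v]vec_mxK; apply/eqP; rewrite [vec_mx v]hE ?linear0 // => y z'.
  pose P i := mmap polyC (fun l => (mxvec (1%:M : 'M[k]_N.+1) 0 l)%:P + v 0 l *: 'X)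
                 (generic_twist f (nz (i, y)) i 0).
  rewrite -(@twist_line_coef1 _ ch0 _ _ _ _ P) => [|i s].
    rewrite -[LHS]add0r; congr (_ + _); apply/colP => i.
    by rewrite !mxE coef1_mmap_line; exact/esym/(Dv (i, y)).
  rewrite horner_mmap.
  have -> : z' = natvec k (nz (i, y)) by apply/colP => l; rewrite !mxE.
  have -> : 1%:M + s *: vec_mx v = vec_mx (mxvec 1%:M + s *: v).
    by rewrite linearD linearZ /= mxvecK.
  have <- := meval_generic_twist f (nz (i, y)) (mxvec 1%:M + s *: v) i.
  apply: meval_eq => l.
  by rewrite hornerD hornerC hornerZ hornerX mxE [X in _ = _ + X]mxE mulrC.
have JT_full : row_full J^T by rewrite /row_full mxrank_tr.
pose sel m : T := enum_val (fullrankfun JT_full m).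
exists (fun m => (sel m).1), (fun m => nz (sel m)), (rowsub (fullrankfun JT_full) J^T)^T.
rewrite unitmx_tr fullrowsub_unit; split=> // v m.
rewrite mxE; apply: eq_bigr => l _.
by rewrite mulrC; do 4!rewrite [X in X * _ = _]mxE.
Qed.

Definition twist_fiber_bound := perron_bound M (N + d).

(** Each entry of a matrix satisfies a Perron relation over the M chosen values of [twist]. The
    integral target [q] is taken in the dominant image and such that no relation becomes trivial
    there; the entries of all solutions are then roots of nonzero polynomials of bounded degree. *)
Lemma twist_fiber : exists (idx : 'I_M -> 'I_N.+1) (z : 'I_M -> 'I_N.+1 -> nat)
    (q : 'I_M -> nat) (rs : 'I_N.+1 * 'I_N.+1 -> seq k),
  [/\ forall ij, (size (rs ij) <= twist_fiber_bound)%N,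
      exists2 A : 'M[k]_N.+1, A \in unitmx &
        forall m, twist f idfun A (natvec k (z m)) (idx m) 0 = (q m)%:R
    & forall A : 'M[k]_N.+1,
        (forall m, twist f idfun A (natvec k (z m)) (idx m) 0 = (q m)%:R) ->
        forall ij, A ij.1 ij.2 \in rs ij].
Proof.
have [idx [z [L [Lunit LE]]]] := generic_twist_jacobian; exists idx, z.
pose c m : {mpoly k[M]} := generic_twist f (z m) (idx m) 0.
(* The determinant: dominance on the locus where it is nonzero yields an invertible solution. *)
pose g : {mpoly k[M]} := \det (\matrix_(i, j) 'X_(mxvec_index i j)).
have gE (a : 'rV[k]_M) : g.@[fun l => a 0 l] = \det (vec_mx a : 'M[k]_N.+1).
  rewrite /g -det_map_mx; congr (\det _); apply/matrixP => i j.
  by rewrite !mxE; exact: mevalXU.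
have cE m (a : 'rV[k]_M) : (c m).@[fun l => a 0 l] = twist f idfun (vec_mx a) (natvec k (z m)) (idx m) 0.
  exact: meval_generic_twist.
have [h h0 hP] : exists2 h : {mpoly k[M]}, h != 0 & forall y, h.@[y] != 0 ->
    exists2 a, g.@[a] != 0 & forall i, (c i).@[a] = y i.
  apply: dominant_image_generic => F hF.
  apply: (vanishing_on_arcs_eq0 ch0 (y0 := fun m => (c m).@[fun l => mxvec (1%:M : 'M[k]_N.+1) 0 l])) => w.
  (* As [L] is the Jacobian, the line from the identity in direction [v] is mapped to an arc with
     tangent [w]. *)
  pose v := (\row_m w m) *m invmx L.
  pose ln l := (mxvec (1%:M : 'M[k]_N.+1) 0 l)%:P + v 0 l *: 'X.
  exists (fun m => mmap polyC ln (c m)), (mmap polyC ln g); split.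
  - apply/eqP => /(congr1 (horner^~ 0)); rewrite horner_mmap horner0.
    have -> : g.@[fun l => (ln l).[0]] = g.@[fun l => mxvec (1%:M : 'M[k]_N.+1) 0 l].
      by apply: meval_eq => l; rewrite !hornerE.
    by rewrite gE mxvecK det1 => /eqP; rewrite oner_eq0.
  - move=> s; rewrite horner_mmap => /hF <-; apply: meval_eq => m.
    by rewrite horner_mmap.
  move=> m; split; last by rewrite coef1_mmap_line -LE mulmxKV // mxE.
  rewrite -horner_coef0 horner_mmap; apply: meval_eq => l.
  by rewrite !hornerE.
have rel ij : exists2 R : 'I_(twist_fiber_bound).+1 -> {mpoly k[M]}, (exists e, R e != 0) &
    forall A : 'M[k]_N.+1, \sum_e (R e).@[fun m => twist f idfun A (natvec k (z m)) (idx m) 0]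
                 * A ij.1 ij.2 ^+ e = 0.
  apply: (perron_relation ch0) => [m|]; first exact: line_poly_twist.
  apply: line_poly_mono (@line_poly_entry _ _ _ ij.1 ij.2).
  by rewrite (leq_trans (ltnW d_gt1)) ?leq_addl.
have /fin_all_exists2[R /fin_all_exists[e Re] RA] := rel.
have H0 : h * \prod_ij R ij (e ij) != 0.
  by rewrite mulf_neq0 //; apply/prodf_neq0 => ij _.
have [q] := mpoly_nat_neq0 ch0 H0; rewrite mevalM mulf_eq0 negb_or => /andP[hq].
rewrite rmorph_prod => /prodf_neq0 Rq.
pose r ij := \poly_(j < (twist_fiber_bound).+1) (R ij (inord j)).@[fun m => (q m)%:R].
have r0 ij : r ij != 0.
  apply/eqP => /(congr1 (fun p : {poly k} => p`_(e ij))); rewrite coef_poly ltn_ord inord_val.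
  by rewrite coef0; apply/eqP/Rq.
have /fin_all_exists[rs rsE] ij : exists s, r ij = lead_coef (r ij) *: \prod_(x <- s) ('X - x%:P).
  by have [s] := closed_field_poly_normal (r ij); exists s.
exists q, rs; split.
- move=> ij; have : (size (r ij) <= twist_fiber_bound.+1)%N by apply: size_poly.
  by rewrite [in size _]rsE size_scale ?lead_coef_eq0 // size_prod_XsubC ltnS.
- have [a ga ca] := hP _ hq; pose A : 'rV[k]_M := \row_l a l.
  have aE (p : {mpoly k[M]}) : p.@[a] = p.@[fun l => A 0 l].
    by apply: meval_eq => l; rewrite mxE.
  exists (vec_mx A); first by rewrite unitmxE unitfE -gE -aE.
  by move=> m; rewrite -cE -aE ca.
move=> A hA ij; have r_lead : lead_coef (r ij) != 0 by rewrite lead_coef_eq0.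
rewrite -root_prod_XsubC -(rootZ _ _ r_lead) -rsE rootE horner_poly -[X in _ == X](RA ij A); apply/eqP; apply: eq_bigr => j _.
rewrite inord_val; congr (_ * _); apply: meval_eq => m.
by rewrite hA.
Qed.

End Slice.

(** * Conjugates and fields of bounded degree *)

Lemma minimal_element (T : Type) (P : T -> Prop) (f : T -> nat) : (exists x, P x) ->
  exists2 x, P x & forall y, P y -> (f x <= f y)%N.
Proof.
move=> [x0 Px0].
have exn : exists n, boolp.asbool (exists2 x, P x & f x = n).
  by exists (f x0); apply/boolp.asboolP; exists x0.
case: (ex_minnP exn) => n /boolp.asboolP[x Px <-] n_min; exists x => // y Py.
by apply: n_min; apply/boolp.asboolP; exists y.
Qed.

(** * Extension of partial field morphisms by Zorn's lemma *)

Section RingGraphs.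

Variables (K : fieldType) (E : closedFieldType) (iota : {rmorphism K -> E}).
Hypothesis E_alg : is_algebraic_closure iota.

Implicit Types (G : E * E -> Prop) (a b : E).

(* Graph of a K-morphism from a subring of E, necessarily a field, to E. *)
Definition ring_graph G :=
  [/\ forall c, G (iota c, iota c),
      forall x y x' y', G (x, y) -> G (x', y') -> G (x - x', y - y'),
      forall x y x' y', G (x, y) -> G (x', y') -> G (x * x', y * y')
    & forall y, G (0, y) -> y = 0].

(** An equation of [a] with nonzero constant term yields the inverse; while the constant term is
    zero, divide by X. *)
Lemma algebraic_inv a : a != 0 -> exists q : {poly K}, a * (map_poly iota q).[a] = 1.
Proof.
move=> a0; have [p p0 pa] := E_alg a.
have [n] := ubnP (size p); elim: n p p0 pa => // n IHn p p0 pa /ltnSE sz_p.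
have def_p : p = (p`_0)%:P + drop_poly 1 p * 'X.
  rewrite -{1}(poly_take_drop 1 p) expr1 /take_poly poly_def big_ord1.
  by rewrite expr0 alg_polyC.
set q := drop_poly 1 p in def_p.
have pa_q : iota p`_0 + (map_poly iota q).[a] * a = 0.
  by have := rootP pa; rewrite {1}def_p rmorphD rmorphM /= map_polyC map_polyX !hornerE.
have [p00|p00] := eqVneq p`_0 0.
  have q0 : q != 0 by apply: contraNneq p0 => q0; rewrite def_p p00 q0 mul0r addr0.
  apply: (IHn q q0).
    by move/eqP: pa_q; rewrite p00 rmorph0 add0r mulf_eq0 (negPf a0) orbF.
  by apply: leq_trans sz_p; rewrite def_p p00 add0r size_mulX // ltnSn.
exists (- (p`_0)^-1 *: q); rewrite map_polyZ hornerZ rmorphN fmorphV mulrCA.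
by move/eqP: pa_q; rewrite addrC addr_eq0 mulrC => /eqP->; rewrite mulrNN mulVf ?fmorph_eq0.
Qed.

Section OneGraph.

Variable G : E * E -> Prop.
Hypothesis G_graph : ring_graph G.

Let G_iota c : G (iota c, iota c). Proof. by case: G_graph. Qed.
Let GB x y x' y' : G (x, y) -> G (x', y') -> G (x - x', y - y').
Proof. by case: G_graph => _ + _ _; apply. Qed.
Let GM x y x' y' : G (x, y) -> G (x', y') -> G (x * x', y * y').
Proof. by case: G_graph => _ _ + _; apply. Qed.
Let G_0inj y : G (0, y) -> y = 0. Proof. by case: G_graph => _ _ _; apply. Qed.

Lemma ring_graph0 : G (0, 0). Proof. by have := G_iota 0; rewrite rmorph0. Qed.

Lemma ring_graph1 : G (1, 1). Proof. by have := G_iota 1; rewrite rmorph1. Qed.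

Lemma ring_graphD x y x' y' : G (x, y) -> G (x', y') -> G (x + x', y + y').
Proof.
move=> h h'; have hN : G (- x', - y').
  by rewrite -[- x']sub0r -[- y']sub0r; apply: GB => //; apply: ring_graph0.
by have := GB h hN; rewrite !opprK.
Qed.

Lemma ring_graph_sum (I : Type) (r : seq I) (F F' : I -> E) :
  (forall i, G (F i, F' i)) -> G (\sum_(i <- r) F i, \sum_(i <- r) F' i).
Proof.
move=> hF; elim: r => [|i r IHr]; first by rewrite !big_nil; apply: ring_graph0.
by rewrite !big_cons; apply: ring_graphD.
Qed.

Lemma ring_graph_fun x y y' : G (x, y) -> G (x, y') -> y = y'.
Proof. by move=> h h'; apply/subr0_eq/G_0inj; rewrite -(subrr x); apply: GB. Qed.

Lemma ring_graph_poly (q : {poly K}) x y :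
  G (x, y) -> G ((map_poly iota q).[x], (map_poly iota q).[y]).
Proof.
move=> h; elim/poly_ind: q => [|q c IHq]; first by rewrite rmorph0 !horner0; apply: ring_graph0.
rewrite rmorphD rmorphM /= map_polyX map_polyC !hornerE.
by apply: ring_graphD; [apply: GM|apply: G_iota].
Qed.

(** The inverse of [x] is a polynomial in [x] over K, so the domain of [G] is a field. *)
Lemma ring_graph_inv x y : G (x, y) -> x != 0 -> exists u v,
  [/\ G (u, v), x * u = 1 & y * v = 1].
Proof.
move=> h x0; have [q hq] := algebraic_inv x0.
exists (map_poly iota q).[x], (map_poly iota q).[y].
have hG := ring_graph_poly q h; split=> //.
by apply: (ring_graph_fun (x := 1)) ring_graph1; rewrite -hq; apply: GM.
Qed.

Definition poly_graph (p p' : {poly E}) := forall i, G (p`_i, p'`_i).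

(** Being only a relation, it makes sense before sending a to b is known to be well defined. *)
Definition adjoin_graph a b (z : E * E) := exists p p',
  [/\ poly_graph p p', z.1 = p.[a] & z.2 = p'.[b]].

Lemma adjoin_graph_sub a b z : G z -> adjoin_graph a b z.
Proof.
case: z => x y h; exists x%:P, y%:P; rewrite /= !hornerC; split=> // i; rewrite !coefC.
by case: ifP => // _; apply: ring_graph0.
Qed.

Lemma adjoin_graph_gen a b : adjoin_graph a b (a, b).
Proof.
exists 'X, 'X; rewrite /= !hornerX; split=> // i; rewrite !coefX.
by case: (i == 1%N); [apply: ring_graph1|apply: ring_graph0].
Qed.

(** Here [m] is a minimal polynomial of [a] over the domain of [G]. If p(a) = 0, the long division
    of p by m is carried out in parallel on p' and m'; it reduces p to 0, and since m'(b) = 0 it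
    leaves p'(b) unchanged. *)
Lemma ring_graph_adjoin a b (m m' : {poly E}) :
    poly_graph m m' -> m != 0 -> m.[a] = 0 -> m'.[b] = 0 ->
    (forall p p', poly_graph p p' -> p != 0 -> p.[a] = 0 -> (size m <= size p)%N) ->
  ring_graph (adjoin_graph a b).
Proof.
move=> hm m0 ma mb m_min; split.
- by move=> c; apply: adjoin_graph_sub.
- move=> x y x' y' [p [p' [/= hp -> ->]]] [q [q' [/= hq -> ->]]].
  exists (p - q), (p' - q'); rewrite /= !hornerE; split=> // i.
  by rewrite !coefB; apply: GB.
- move=> x y x' y' [p [p' [/= hp -> ->]]] [q [q' [/= hq -> ->]]].
  exists (p * q), (p' * q'); rewrite /= !hornerM; split=> // i.
  by rewrite !coefM; apply: ring_graph_sum => j; apply: GM.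
move=> y [p [p' [/= hp pa ->]]]; move/esym: pa.
have [n] := ubnP (size p); elim: n p p' hp => // n IHn p p' hp /ltnSE sz_p pa.
have [p0|p0] := eqVneq p 0.
  suff -> : p' = 0 by rewrite horner0.
  by apply/polyP => i; rewrite coef0; apply: G_0inj; have := hp i; rewrite p0 coef0.
have le_mp := m_min _ _ hp p0 pa.
have lm0 : m`_(size m).-1 != 0 by rewrite -lead_coefE lead_coef_eq0.
have [u [v [huv lu _]]] := ring_graph_inv (hm (size m).-1) lm0.
pose c := p`_(size p).-1 * u; pose c' := p'`_(size p).-1 * v.
have hc : G (c, c') by apply: GM.
pose e := (size p - size m)%N.
have hp1 : poly_graph (p - c *: ('X^e * m)) (p' - c' *: ('X^e * m')).
  move=> i; rewrite !coefB !coefZ !coefXnM; apply: GB => //; apply: GM => //.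
  by case: ifP => _; [apply: ring_graph0|apply: hm].
have sz_p1 : (size (p - c *: ('X^e * m))%R < n)%N.
  apply: leq_trans sz_p; rewrite [X in (_ < X)%N](polySpred p0) ltnS.
  apply/leq_sizeP => i le_i; rewrite coefB coefZ coefXnM.
  have le_ei : (e <= i)%N.
    apply: leq_trans le_i; rewrite -ltnS -(polySpred p0) /e ltn_subrL.
    by rewrite !size_poly_gt0 m0 p0.
  rewrite ltnNge le_ei /=; move: le_i; rewrite leq_eqVlt => /orP[/eqP <-|lt_i].
    have -> : ((size p).-1 - e)%N = (size m).-1.
      by rewrite /e -subn1 -subnAC subKn // subn1.
    by rewrite /c -mulrA [u * _]mulrC lu mulr1 subrr.
  rewrite !nth_default ?mulr0 ?subrr //; last by rewrite -(prednK (_ : 0 < size p)%N) ?size_poly_gt0.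
  have sp_gt0 : (0 < size p)%N by rewrite size_poly_gt0.
  by rewrite leq_subRL // /e subnK // -(prednK sp_gt0).
have p1a : (p - c *: ('X^e * m)).[a] = 0 by rewrite hornerD hornerN hornerZ hornerM ma pa !mulr0 subrr.
have := IHn _ _ hp1 sz_p1 p1a.
by rewrite hornerD hornerN hornerZ hornerM mb !mulr0 subr0.
Qed.

End OneGraph.

Definition maximal_graph G := ring_graph G /\
  forall G', ring_graph G' -> (forall z, G z -> G' z) -> forall z, G' z -> G z.

Lemma maximal_graph_exists G0 : ring_graph G0 ->
  exists2 G, maximal_graph G & forall z, G0 z -> G z.
Proof.
(* Adding [G0] to every set makes even the union of the empty chain admissible. *)
move=> hG0; pose U (A : E * E -> Prop) z := A z \/ G0 z.
have [F FP totF|A [PA maxA]] := @classical_sets.Zorn_bigcup _ (fun A => ring_graph (U A)).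
  pose B := classical_sets.bigcup F id.
  have inU A z : F A -> U A z -> U B z by move=> FA [Az|?]; [left; exists A|right].
  have up z : U B z -> G0 z \/ exists2 A, F A & U A z.
    by move=> [[A FA Az]|]; [right; exists A => //; left|left].
  have up2 z z' : U B z -> U B z' ->
      exists2 A, ring_graph A & [/\ forall t, A t -> U B t, A z & A z'].
    move=> /up[hz|[A FA hz]] /up[hz'|[A' FA' hz']].
    - by exists G0 => //; split=> // t; right.
    - by exists (U A'); [apply: FP|split=> [t||//]; [apply: inU|right]].
    - by exists (U A); [apply: FP|split=> [t|//|]; [apply: inU|right]].
    have [sAA'|sA'A] := totF _ _ FA FA'.
      exists (U A'); [exact: FP|split=> [t||//]; first exact: inU].
      by case: hz => [/sAA'|]; [left|right].
    exists (U A); [exact: FP|split=> [t|//|]; first exact: inU].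
    by case: hz' => [/sA'A|]; [left|right].
  split.
  - by move=> c; right; case: hG0.
  - by move=> x y x' y' /up2/[apply] -[A [_ hB _ _] [sA hz hz']]; apply/sA/hB.
  - by move=> x y x' y' /up2/[apply] -[A [_ _ hM _] [sA hz hz']]; apply/sA/hM.
  by move=> y hy; have [A [_ _ _ h0] [_ /h0]] := up2 _ _ hy hy.
exists (U A); last by move=> z; right.
split=> // G' hG' sAG' z G'z; apply: boolp.contrapT => nUz.
have /maxA[] : classical_sets.proper A G'.
  by split=> [t At|sG'A]; [apply: sAG'; left|apply: nUz; left; apply: sG'A].
suff -> : U G' = G' by [].
apply: boolp.funext => t; apply: boolp.propext; split; last by left.
by case=> // G0t; apply: sAG'; right.
Qed.

(** A minimal polynomial of [a] over the domain is carried to one with a root b in E. Adjoining (a,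
    b) gives a ring graph, which by maximality is no larger. *)
Lemma maximal_graph_total G : maximal_graph G -> forall a, exists b, G (a, b).
Proof.
move=> [hG maxG] a.
have [|[m m'] /= [hm m0 ma] m_min] := @minimal_element _
  (fun mm => [/\ poly_graph G mm.1 mm.2, mm.1 != 0 & mm.1.[a] = 0]) (fun mm => size mm.1).
  have [p p0 pa] := E_alg a; exists (map_poly iota p, map_poly iota p); split=> /=.
  - by move=> i; rewrite coef_map; case: hG => hi _ _ _; apply: hi.
  - by rewrite map_poly_eq0.
  exact/rootP.
have lm0 : m`_(size m).-1 != 0 by rewrite -lead_coefE lead_coef_eq0.
have [u [v [_ _ lv]]] := ring_graph_inv hG (hm (size m).-1) lm0.
have sz_m : (1 < size m)%N by rewrite (root_size_gt1 (a := a)) //; apply/rootP.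
(* The leading coefficient of [m] goes to a unit, so [m'] is not constant. *)
have [b /rootP m'b] : exists b, root m' b.
  apply/closed_rootP; rewrite neq_ltn; apply/orP; right; rewrite ltnNge; apply/negP => sz_m'.
  move: lv; rewrite nth_default; last by rewrite -ltnS prednK ?(leq_ltn_trans sz_m') // ltnW.
  by rewrite mul0r => /eqP; rewrite eq_sym oner_eq0.
have hG' : ring_graph (adjoin_graph G a b).
  by apply: (ring_graph_adjoin hG hm) => // p p' hp p0 pa; apply: (m_min (p, p')).
exists b; apply: (maxG _ hG') => [z|]; first exact: adjoin_graph_sub.
exact: adjoin_graph_gen.
Qed.

Lemma maximal_graph_aut G : maximal_graph G ->
  exists2 s : {rmorphism E -> E}, in_Gal iota s & forall a, G (a, s a).
Proof.
move=> maxG; have [hG _] := maxG.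
have [s hs] := boolp.choice (maximal_graph_total maxG).
have [Gi GB GM _] := hG.
have sB : zmod_morphism s.
  by move=> x y; apply: (ring_graph_fun hG (hs _)); apply: GB.
have sM : monoid_morphism s.
  split; first by apply: (ring_graph_fun hG (hs _)); apply: ring_graph1.
  by move=> x y; apply: (ring_graph_fun hG (hs _)); apply: GM.
pose s' : {rmorphism E -> E} := HB.pack s
  (GRing.isZmodMorphism.Build _ _ s sB) (GRing.isMonoidMorphism.Build _ _ s sM).
have s_iota c : s' (iota c) = iota c by apply: (ring_graph_fun hG (hs _)).
exists s' => //; split=> //.
(* Being injective, [s'] permutes the finite set of roots of a polynomial over K. *)
have s_surj y : exists x, s' x = y.
  have [p p0 py] := E_alg y; have [rs def_p] := closed_field_poly_normal (map_poly iota p).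
  have ip0 : lead_coef (map_poly iota p) != 0 by rewrite lead_coef_eq0 map_poly_eq0.
  have rsP z : root (map_poly iota p) z = (z \in undup rs).
    by rewrite mem_undup def_p rootZ // root_prod_XsubC.
  have s_rs : {subset map s' (undup rs) <= undup rs}.
    move=> _ /mapP[z z_rs ->]; rewrite -rsP -[map_poly iota p](_ : map_poly s' (map_poly iota p) = _).
      by rewrite fmorph_root rsP.
    by rewrite -map_poly_comp; apply: eq_map_poly => c /=; apply: s_iota.
  have [||_ rs_s] := @uniq_min_size _ (map s' (undup rs)) (undup rs) _ s_rs.
  - by rewrite map_inj_uniq ?undup_uniq //; apply: fmorph_inj.
  - by rewrite size_map.
  by have := py; rewrite rsP -rs_s => /mapP[x _ ->]; exists x.
have [t ht] := boolp.choice s_surj.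
by exists t => // x; apply: (fmorph_inj s'); rewrite ht.
Qed.

(** The minimal polynomial of [a] over K, up to a nonzero scalar. *)
Definition min_root_poly (p : {poly K}) a := [/\ p != 0, root (map_poly iota p) a
  & forall q, q != 0 -> root (map_poly iota q) a -> (size p <= size q)%N].

(** The K-isomorphism from K(a) to K(b) extends to a maximal graph, which is that of an
    automorphism. *)
Lemma conjugate_automorphism p a b : min_root_poly p a -> root (map_poly iota p) b ->
  exists2 s : {rmorphism E -> E}, in_Gal iota s & s a = b.
Proof.
move=> [p0 pa p_min] pb.
pose D z := exists c, z = (iota c, iota c).
have hD : ring_graph D.
  split.
  - by move=> c; exists c.
  - by move=> _ _ _ _ [c [-> ->]] [c' [-> ->]]; exists (c - c'); rewrite rmorphB.
  - by move=> _ _ _ _ [c [-> ->]] [c' [-> ->]]; exists (c * c'); rewrite rmorphM.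
  by move=> _ [c [/esym/eqP + ->]]; rewrite fmorph_eq0 => /eqP ->; rewrite rmorph0.
have hG0 : ring_graph (adjoin_graph D a b).
  apply: (ring_graph_adjoin hD (m := map_poly iota p) (m' := map_poly iota p)).
  - by move=> i; rewrite coef_map; exists p`_i.
  - by rewrite map_poly_eq0.
  - exact/rootP.
  - exact/rootP.
  move=> q q' hq q0 qa.
  have /fin_all_exists[c hc] (i : 'I_(size q)) : exists c, q`_i = iota c.
    by have [c [-> _]] := hq i; exists c.
  pose r := \poly_(i < size q) (if insub i is Some j then c j else 0).
  have def_q : q = map_poly iota r.
    apply/polyP => i; rewrite coef_map coef_poly; case: ltnP => [lt_i|le_i].
      by rewrite insubT; apply: (hc (Ordinal lt_i)).
    by rewrite nth_default //; apply/esym/rmorph0.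
  rewrite size_map_poly def_q size_map_poly; apply: p_min.
    by rewrite -(map_poly_eq0 iota) -def_q.
  by rewrite -def_q; apply/rootP.
have [G maxG sG] := maximal_graph_exists hG0.
have [s s_Gal hs] := maximal_graph_aut maxG; exists s => //.
have [hG _] := maxG; apply: (ring_graph_fun hG (hs a)); apply: sG.
exact: adjoin_graph_gen.
Qed.

Lemma min_root_poly_exists a : exists p, min_root_poly p a.
Proof.
have [|p [p0 pa] p_min] := @minimal_element _
  (fun p => p != 0 /\ root (map_poly iota p) a) (fun p => size p).
  by have [p p0 pa] := E_alg a; exists p.
by exists p; split=> // q q0 qa; apply: p_min.
Qed.

Hypothesis K_char0 : [pchar K] =i pred0.

Lemma min_root_poly_separable p a : min_root_poly p a -> separable_poly p.
Proof.
move=> [p0 pa p_min]; rewrite separable_poly.unlock coprimep_def; apply/negPn/negP => r1.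
pose r := gcdp p p^`(); have r0 : r != 0 by rewrite gcdp_eq0 negb_and p0.
have sz_p : (1 < size p)%N.
  by rewrite -(size_map_poly iota) (root_size_gt1 (a := a)) // map_poly_eq0.
have dp0 : p^`() != 0.
  apply/eqP => /(congr1 (fun q : {poly K} => q`_(size p).-2)).
  rewrite coef0 coef_deriv prednK; last by rewrite -subn1 subn_gt0.
  move/eqP; rewrite -lead_coefE -mulr_natr mulf_eq0 lead_coef_eq0 (negPf p0) /=.
  have /pcharf0P-> := K_char0.
  by rewrite -subn1 subn_eq0 leqNgt sz_p.
have sz_r : (size r < size p)%N.
  by rewrite (leq_ltn_trans _ (lt_size_deriv p0)) // dvdp_leq ?dvdp_gcdr.
have /dvdpP[q def_p] : r %| p by apply: dvdp_gcdl.
have q0 : q != 0 by apply: contraNneq p0 => q0; rewrite def_p q0 mul0r.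
have := pa; rewrite {1}def_p rmorphM rootM => /orP[qa|ra].
  have := p_min q q0 qa; rewrite [in X in (X <= _)%N]def_p size_mul // leqNgt => /negP[].
  rewrite -ltnS prednK ?addn_gt0 ?size_poly_gt0 ?q0 // -addn1 ltn_add2l.
  by rewrite ltn_neqAle eq_sym r1 size_poly_gt0.
by have := p_min r r0 ra; rewrite leqNgt sz_r.
Qed.

(** * Elements determined by finitely many labels *)

Variables (I : finType) (lab : {rmorphism E -> E} -> I -> Prop).
Hypothesis lab_total : forall s, in_Gal iota s -> exists i, lab s i.

(** Labels play the part of the cosets of a subgroup of finite index, and the elements so determined
    that of its fixed field; no subgroup has to be exhibited. *)
Definition label_determined a := forall s s' i,
  in_Gal iota s -> in_Gal iota s' -> lab s i -> lab s' i -> s a = s' a.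

(** Every root of [p] is the image of [a] under an automorphism, distinct roots get distinct labels,
    and by separability there are as many roots as the degree. *)
Lemma label_determined_degree p a :
  min_root_poly p a -> label_determined a -> (size p <= #|I|.+1)%N.
Proof.
move=> p_min a_lab; have [p0 pa _] := p_min.
have [rs def_p] := closed_field_poly_normal (map_poly iota p).
have lp0 : lead_coef (map_poly iota p) != 0 by rewrite lead_coef_eq0 map_poly_eq0.
have rs_uniq : uniq rs.
  rewrite -separable_prod_XsubC; have := min_root_poly_separable p_min.
  rewrite -(separable_map iota) def_p separable_poly.unlock derivZ.
  by rewrite coprimepZl // coprimepZr.
have /fin_all_exists[l hl] (i : 'I_(size rs)) : exists l, exists2 s : {rmorphism E -> E},
    in_Gal iota s & lab s l /\ s a = rs`_i.
  have [s s_Gal sa] : exists2 s : {rmorphism E -> E}, in_Gal iota s & s a = rs`_i.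
    apply: conjugate_automorphism p_min _.
    by rewrite def_p rootZ // root_prod_XsubC mem_nth.
  by have [l hl] := lab_total s_Gal; exists l, s.
have l_inj : injective l.
  move=> i j eq_l; have [s s_Gal [sl sa]] := hl i; have [s' s'_Gal [s'l s'a]] := hl j.
  apply/val_inj/eqP; rewrite -(nth_uniq 0 _ _ rs_uniq) ?ltn_ord // -sa -s'a; apply/eqP.
  by apply: a_lab s_Gal s'_Gal sl _; rewrite eq_l.
have := leq_card l l_inj; rewrite card_ord -ltnS => /(leq_trans _); apply.
by rewrite -(size_map_poly iota) def_p size_scale // size_prod_XsubC.
Qed.

Lemma min_root_poly_irreducible p a : min_root_poly p a -> irreducible_poly p.
Proof.
by move=> [p0 pa p_min]; apply/(subfx_irreducibleP pa p0) => q qa q0; apply: p_min.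
Qed.

Lemma dim_SubFieldExtType p a (pa : root (map_poly iota p) a) (irr_p : irreducible_poly p) :
  \dim {: SubFieldExtType pa irr_p} = (size p).-1.
Proof. by rewrite dimvf. Qed.

(* In K(z) the powers of t below its degree are independent, hence a basis. *)
Lemma min_root_poly_generates p q t z (r r' : {poly K}) :
    min_root_poly p t -> min_root_poly q z -> (size q <= size p)%N ->
    (map_poly iota r).[z] = t ->
  exists r'' : {poly K}, (map_poly iota r'').[t] = (map_poly iota r').[z].
Proof.
move=> [p0 pt p_min] qz_min sz_qp rz.
have [q0 qz _] := qz_min; have irr_q := min_root_poly_irreducible qz_min.
pose L := SubFieldExtType qz irr_q.
pose j : {rmorphism L -> E} := @subfx_inj _ _ iota z q.
pose u : L := subfx_eval iota z q r.
have ju : j u = t := etrans (subfx_inj_eval qz q0 r) rz.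
have jZ (c : K) (x : L) : j (c *: x) = iota c * j x by apply: subfx_injZ.
pose X := [tuple u ^+ i | i < (size p).-1].
have jsum (c : 'I_(size p).-1 -> K) :
    j (\sum_i c i *: X`_i) = (map_poly iota (\poly_(i < (size p).-1) oapp c 0 (insub i))).[t].
  rewrite rmorph_sum poly_def rmorph_sum horner_sum; apply: eq_bigr => i _ /=.
  by rewrite map_polyZ map_polyXn hornerZ hornerXn jZ nth_mktuple rmorphXn /= ju valK.
have X_free : free X.
  apply/freeP => c c0 i; have := jsum c; rewrite c0 rmorph0 => /esym/rootP c_t.
  set cp := \poly_(i < _) _ in c_t.
  have [cp0|cp0] := eqVneq cp 0.
    by have := congr1 (fun w : {poly K} => w`_i) cp0; rewrite coef0 coef_poly ltn_ord valK.
  have := p_min cp cp0 c_t; rewrite leqNgt (leq_ltn_trans (size_poly _ _)) //.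
  by rewrite prednK // size_poly_gt0.
have X_basis : basis_of {:L} X.
  rewrite basisEfree X_free subvf size_tuple dim_SubFieldExtType.
  by rewrite -ltnS !prednK ?size_poly_gt0.
pose w : L := subfx_eval iota z q r'.
exists (\poly_(i < (size p).-1) oapp ((coord X)^~ w) 0 (insub i)).
rewrite -jsum -(coord_basis X_basis (memvf w)).
exact: (subfx_inj_eval qz q0 r').
Qed.

(** [L] is K(t) for a label-determined t of maximal degree. For any other such a, a primitive
    element of K(t, a) is again label-determined, so its degree is at most that of t, and K(t)
    contains a. *)
Lemma label_determined_field : exists (L : fieldExtType K) (j : {rmorphism L -> E}),
  [/\ forall c : K, j c%:A = iota c, (\dim {:L} <= #|I|)%N
    & forall a, label_determined a -> exists c : L, j c = a].
Proof.
(* Minimizing the difference maximizes the degree; the subtraction is exact by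
   [label_determined_degree]. *)
have [|[t p] /= [t_lab p_min] t_max] := @minimal_element _
  (fun x => label_determined x.1 /\ min_root_poly x.2 x.1) (fun x => #|I|.+1 - size x.2)%N.
  have [p hp] := min_root_poly_exists 0; exists (0, p); split=> //= s s' i _ _ _ _.
  by rewrite !rmorph0.
have [p0 pt _] := p_min; have irr_p := min_root_poly_irreducible p_min.
exists (SubFieldExtType pt irr_p), (@subfx_inj _ _ iota t p); split.
- by move=> a; apply: subfx_inj_base.
- by rewrite dim_SubFieldExtType -subn1 leq_subLR add1n; apply: label_determined_degree p_min _.
move=> a a_lab; have [pa [pa0 paa _]] := min_root_poly_exists a.
have [n [[q0 q0z] [q1 q1z]]] := pchar0_PET p0 pt pa0 paa K_char0.
set z := a *+ n - t in q0z q1z.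
have z_lab : label_determined z.
  move=> s s' i sG s'G si s'i; rewrite !rmorphB !rmorphMn /=.
  by rewrite (a_lab s s' i) // (t_lab s s' i).
have [pz pz_min] := min_root_poly_exists z.
have sz_z : (size pz <= size p)%N.
  have := t_max (z, pz) (conj z_lab pz_min); rewrite /= leq_sub2lE //.
  exact: label_determined_degree pz_min z_lab.
have [r rt] := min_root_poly_generates q1 p_min pz_min sz_z q0z.
by exists (subfx_eval iota t p r); rewrite -q1z -rt; apply: (subfx_inj_eval pt p0 r).
Qed.

End RingGraphs.

(** * Fields of definition *)

Section ProjEq.

Variables (F : fieldType) (n : nat).
Implicit Types x y z : 'cV[F]_n.

Lemma proj_eq_sym x y : proj_eq x y -> proj_eq y x.
Proof. by move=> [c c0 ->]; exists c^-1; rewrite ?invr_eq0 // scalerK. Qed.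

Lemma proj_eq_trans x y z : proj_eq x y -> proj_eq y z -> proj_eq x z.
Proof.
by move=> [c c0 ->] [c' c'0 ->]; exists (c' * c); rewrite ?mulf_neq0 // scalerA.
Qed.

Lemma proj_eqZ c x : c != 0 -> proj_eq x (c *: x).
Proof. by exists c. Qed.

Lemma proj_eq_mulmx (A : 'M[F]_n) x y : proj_eq x y -> proj_eq (A *m x) (A *m y).
Proof. by move=> [c c0 ->]; exists c; rewrite // scalemxAr. Qed.

(** The scalar is a quotient of coordinates, so it comes from F. *)
Lemma proj_eq_map_inv (E : fieldType) (j : {rmorphism F -> E}) x y :
  proj_eq (map_mx j x) (map_mx j y) -> proj_eq x y.
Proof.
move=> [c c0 def_y]; have [x0|/cV0Pn[i xi]] := eqVneq x 0.
  exists 1; rewrite ?oner_eq0 // scale1r x0; apply: (map_mx_inj (f := j)).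
  by rewrite def_y x0 raddf0 scaler0.
have jc : c = j (y i 0 / x i 0).
  have := congr1 (fun v : 'cV[E]_n => v i 0) def_y; rewrite !mxE fmorph_div => ->.
  by rewrite mulfK // fmorph_eq0.
exists (y i 0 / x i 0); first by rewrite -(fmorph_eq0 j) -jc.
by apply: (map_mx_inj (f := j)); rewrite map_mxZ -jc.
Qed.

(** Prescribing a coordinate equal to 1 removes the scalar ambiguity, so that conjugates of a point
    can be compared as vectors. *)
Lemma proj_eq_normalized (i : 'I_n) u x y :
  proj_eq u x -> proj_eq u y -> x i 0 = 1 -> y i 0 = 1 -> x = y.
Proof.
move=> [a a0 ->] [b b0 ->]; rewrite !mxE => au bu; congr (_ *: _).
have u0 : u i 0 != 0 by apply: contra_eq_neq au => ->; rewrite mulr0 eq_sym oner_eq0.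
by apply: (mulIf u0); rewrite au bu.
Qed.

End ProjEq.

(** * Conjugation of forms and the action of field morphisms *)

Section ConjForms.

Variables (F : fieldType) (N : nat).
Implicit Types (A B : 'M[F]_N.+1) (f : 'I_N.+1 -> {mpoly F[N.+1]}).

Lemma eval_conj_forms A f z :
  eval_forms (conj_forms A f) z = invmx A *m eval_forms f (A *m z).
Proof.
apply/colP => i; rewrite !mxE raddf_sum; apply: eq_bigr => j _ /=.
rewrite mevalZ mxE; congr (_ * _); rewrite comp_mpoly_meval; apply: meval_eq => m.
rewrite tnth_mktuple raddf_sum mxE; apply: eq_bigr => l _ /=.
by rewrite mevalZ mevalXU.
Qed.

Lemma conj_forms_homog d A f :
  (forall i, f i \is d.-homog) -> forall i, conj_forms A f i \is d.-homog.
Proof.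
move=> f_homog i; apply: rpred_sum => j _; apply: rpredZ.
rewrite comp_mpolyEX big_seq; apply: rpred_sum => m mf; apply: rpredZ.
have /dhomogP/(_ m mf) <- := f_homog j.
rewrite comp_mpolyX /= mdegE; elim/big_rec2: _ => [|l e p _ hp]; first exact: dhomog1.
apply: dhomogM => //; rewrite -[X in X.-homog]mul1n; apply: dhomogMn.
rewrite tnth_mktuple; apply: rpred_sum => h _; apply: rpredZ.
by rewrite dhomogX /= mdeg1.
Qed.

Lemma map_eval_forms (E : fieldType) (j : {rmorphism F -> E}) f z :
  map_mx j (eval_forms f z) = eval_forms (fun i => map_mpoly j (f i)) (map_mx j z).
Proof.
apply/colP => i; rewrite !mxE !mevalE (perm_big _ (msupp_map_mpoly _ (fmorph_inj j))) /=.
rewrite rmorph_sum; apply: eq_bigr => m _.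
rewrite mcoeff_map_mpoly rmorphM rmorph_prod; congr (_ * _).
by apply: eq_bigr => l _; rewrite mxE rmorphXn.
Qed.

End ConjForms.

Lemma closed_field_root (k : closedFieldType) m (c : k) : (0 < m)%N -> exists a, a ^+ m = c.
Proof.
move=> m0; have [a a_m] := @solve_monicpoly k m (fun i => if i == 0%N then c else 0) m0.
exists a; rewrite a_m; case: m m0 {a_m} => // m _; rewrite big_ord_recl big1 ?addr0 ?mulr1 //.
by move=> i _; rewrite mul0r.
Qed.

Section EvalCoords.

Variables (k : fieldType) (N : nat).

Lemma eval_forms_inj (f g : 'I_N.+1 -> {mpoly k[N.+1]}) : [pchar k] =i pred0 ->
  (forall z, eval_forms f (natvec k z) = eval_forms g (natvec k z)) -> f =1 g.
Proof.
move=> ch0 fg i; apply/eqP; rewrite -subr_eq0; apply/negPn/negP.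
move=> /(mpoly_nat_neq0 ch0)[z]; rewrite mevalB subr_eq0 => /eqP[].
have := congr1 (fun w : 'cV_N.+1 => w i 0) (fg z); rewrite !mxE => e.
by apply: etrans (etrans e _); apply: meval_eq => l; rewrite mxE.
Qed.

Lemma eval_formsZ (f : 'I_N.+1 -> {mpoly k[N.+1]}) c z :
  eval_forms (fun i => c *: f i) z = c *: eval_forms f z.
Proof. by apply/colP => i; rewrite !mxE mevalZ. Qed.

Lemma eval_forms_homog (f : 'I_N.+1 -> {mpoly k[N.+1]}) d c z :
  (forall i, f i \is d.-homog) -> eval_forms f (c *: z) = c ^+ d *: eval_forms f z.
Proof.
move=> f_homog; apply/colP => i; rewrite !mxE -meval_homog //.
by apply: meval_eq => l; rewrite mxE.
Qed.

End EvalCoords.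

(** The factor det A makes the values those of [twist] when A is invertible. *)
Definition conj_det_forms (F : fieldType) N (A : 'M[F]_N.+1)
    (f : 'I_N.+1 -> {mpoly F[N.+1]}) : 'I_N.+1 -> {mpoly F[N.+1]} :=
  fun i => \det A *: conj_forms A f i.

Section ConjDetForms.

Variables (k : closedFieldType) (ch0 : [pchar k] =i pred0).
Variables (N d : nat) (f : 'I_N.+1 -> {mpoly k[N.+1]}).
Hypotheses (d_gt0 : (0 < d)%N) (f_homog : forall i, f i \is d.-homog).

Lemma eval_conj_det_forms A z : eval_forms (conj_det_forms A f) z =
  \det A *: (invmx A *m eval_forms f (A *m z)).
Proof. by rewrite eval_formsZ eval_conj_forms. Qed.

Lemma twist_conj_det_forms A z : A \in unitmx ->
  twist f idfun A z = eval_forms (conj_det_forms A f) z.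
Proof.
by move=> A_unit; rewrite eval_conj_det_forms scalemxAr -mul_twist mulKmx.
Qed.

Lemma conj_conj_det_forms A : A \in unitmx ->
  conj_forms (invmx A) (conj_det_forms A f) =1 fun i => \det A *: f i.
Proof.
move=> A_unit; apply: eval_forms_inj => // z.
rewrite eval_conj_forms eval_conj_det_forms eval_formsZ invmxK -scalemxAr.
by rewrite mulKVmx // mulKVmx.
Qed.

(** Scaling a matrix by mu scales [conj_det_forms] by mu^(N + d): the determinant gives mu^(N + 1),
    the inverse mu^-1, the forms mu^d. The choice mu^(N + d) = det A / c absorbs the scalar in the
    equivalence between f and its conjugate. *)
Lemma conj_det_forms_map (s : {rmorphism k -> k}) (A0 A : 'M[k]_N.+1) c :
    A0 \in unitmx -> A \in unitmx -> c != 0 ->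
    (forall i, f i = c *: conj_forms A (fun i => map_mpoly s (f i)) i) ->
  exists mu, let A' := mu *: (invmx A *m map_mx s A0) in
    [/\ mu != 0, A' \in unitmx
      & forall i, map_mpoly s (conj_det_forms A0 f i) = conj_det_forms A' f i].
Proof.
move=> A0_unit A_unit c0 def_f; pose sf i := map_mpoly s (f i).
have sA0_unit : map_mx s A0 \in unitmx by rewrite map_unitmx.
have dA0 : \det A != 0 by rewrite -unitfE -unitmxE.
have fE w : eval_forms f w = c *: (invmx A *m eval_forms sf (A *m w)).
  rewrite -eval_conj_forms -eval_formsZ; apply/colP => i.
  by rewrite !mxE {1}def_f.
have sf_homog i : sf i \is d.-homog.
  apply/dhomogP => m; rewrite mcoeff_msupp mcoeff_map_mpoly fmorph_eq0 -mcoeff_msupp.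
  by have /dhomogP := f_homog i; apply.
have Nd_gt0 : (0 < N + d)%N by rewrite addn_gt0 d_gt0 orbT.
have [mu muE] := closed_field_root (\det A / c) Nd_gt0.
exists mu => A'.
have mu0 : mu != 0.
  have : mu ^+ (N + d) != 0 by rewrite muE mulf_neq0 ?invr_eq0.
  by rewrite expf_eq0 negb_and Nd_gt0.
have A'_unit : A' \in unitmx.
  by rewrite unitmxZ ?unitfE // unitmx_mul unitmx_inv A_unit.
split; [exact: mu0|exact: A'_unit|].
apply: (eval_forms_inj ch0) => z.
have sz : map_mx s (natvec k z) = natvec k z.
  by apply/colP => i; rewrite !mxE rmorph_nat.
have -> : eval_forms (fun i => map_mpoly s (conj_det_forms A0 f i)) (natvec k z) =
    map_mx s (eval_forms (conj_det_forms A0 f) (natvec k z)).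
  by rewrite map_eval_forms sz.
pose z' := map_mx s A0 *m natvec k z.
transitivity (\det (map_mx s A0) *: (invmx (map_mx s A0) *m eval_forms sf z')).
  rewrite (eval_conj_det_forms A0) map_mxZ map_mxM map_invmx map_eval_forms map_mxM sz.
  by rewrite det_map_mx.
apply/esym; apply: etrans (eval_conj_det_forms A' _) _.
rewrite (fE (A' *m natvec k z)).
have -> : A *m (A' *m natvec k z) = mu *: z'.
  by rewrite -scalemxAl -scalemxAr -mulmxA mulKVmx.
rewrite (eval_forms_homog _ _ sf_homog) -!scalemxAr.
have -> : invmx A' *m (invmx A *m eval_forms sf z') =
    mu^-1 *: (invmx (map_mx s A0) *m eval_forms sf z').
  apply: (canLR (mulKmx A'_unit)).
  by rewrite -scalemxAr -scalemxAl scalerA mulVf // scale1r -mulmxA mulKVmx.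
rewrite !scalerA; congr (_ *: _).
rewrite detZ det_mulmx det_inv.
have detA : \det A = mu ^+ N * mu ^+ d * c by rewrite -exprD muE divfK.
rewrite detA exprS; field.
by rewrite c0 mu0 !expf_neq0.
Qed.

End ConjDetForms.

Lemma map_mpoly_idfun (R : nzRingType) n (p : {mpoly R[n]}) : map_mpoly idfun p = p.
Proof. by apply/mpolyP => m; rewrite mcoeff_map_mpoly. Qed.

Section Descent.

Variables (L E : fieldType) (j : {rmorphism L -> E}).

Lemma mpoly_preimage n (p : {mpoly E[n]}) :
  (forall m, exists c, j c = p@_m) -> exists q, map_mpoly j q = p.
Proof.
move=> /boolp.choice[g hg]; exists (\sum_(m <- msupp p) g m *: 'X_[m]).
rewrite raddf_sum [RHS]mpolyE; apply: eq_bigr => m _ /=.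
by rewrite map_mpolyZ map_mpolyX hg.
Qed.

Lemma coords_preimage N (V : finType) (y : coords E N V) :
  (forall i m, exists c, j c = (forms y i)@_m) ->
  (forall v i, exists c, j c = pts y v i 0) ->
  exists y', map_coords j y' = y.
Proof.
case: y => g Q /= hg hQ.
have [g' hg'] := boolp.choice (fun i => mpoly_preimage (hg i)).
have [Q' hQ'] : exists Q' : V -> 'cV[L]_N.+1, forall v, map_mx j (Q' v) = Q v.
  have [Q' hQ'] := boolp.choice (fun vi : V * 'I_N.+1 => hQ vi.1 vi.2).
  exists (fun v => \col_i Q' (v, i)) => v; apply/colP => i.
  by rewrite !mxE hQ'.
exists (Coords g' Q'); rewrite /map_coords /=; congr Coords; exact/boolp.funext.
Qed.

End Descent.

Section Model.

Variables (k : closedFieldType) (ch0 : [pchar k] =i pred0) (N d : nat) (P : portrait).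
Variables (x : coords k N (vert P)) (A : 'M[k]_N.+1).
Hypotheses (A_unit : A \in unitmx) (xP : is_EndP_point (idfun : {rmorphism k -> k}) d x).

Let f := forms x.
Let detA : \det A != 0. Proof. by rewrite -unitfE -unitmxE. Qed.
Let f_homog i : f i \is d.-homog. Proof. by case: xP => -[]. Qed.
Let Q v := invmx A *m pts x v.

Lemma EndP_eval_neq0 z : z != 0 -> eval_forms f z != 0.
Proof.
case: xP => -[_ f_nz] _ _ _ /f_nz; apply: contra_neq => f0.
apply/colP => i; have := congr1 (fun w : 'cV_N.+1 => w i 0) f0; rewrite !mxE.
by rewrite map_mpoly_idfun.
Qed.

Lemma unitmx_mul_eq0 (B : 'M[k]_N.+1) (z : 'cV[k]_N.+1) :
  B \in unitmx -> (B *m z == 0) = (z == 0).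
Proof.
move=> B_unit; apply/eqP/eqP => [e|->]; last by rewrite mulmx0.
by rewrite -(mulKmx B_unit z) e mulmx0.
Qed.

(** The conditions on [y] can be checked in [k], where [y] represents the conjugate of [x] by [A].
    Points need to agree only up to scalars. *)
Lemma EndP_point_descends (L : fieldType) (j : {rmorphism L -> k}) (y : coords L N (vert P)) :
  forms (map_coords j y) =1 conj_det_forms A f ->
  (forall v, proj_eq (Q v) (pts (map_coords j y) v)) ->
  is_EndP_point j d y /\ moduli_eq (map_coords j y) x.
Proof.
move=> /= yf yQ; have [_ P_nz P_dist P_map] := xP.
have Ai_unit : invmx A \in unitmx by rewrite unitmx_inv.
have Q_nz v : Q v != 0 by rewrite unitmx_mul_eq0.
have y_eval z : eval_forms (fun i => map_mpoly j (forms y i)) z =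
    \det A *: (invmx A *m eval_forms f (A *m z)).
  rewrite -eval_conj_det_forms; apply/colP => i; rewrite mxE [RHS]mxE.
  by rewrite yf.
split.
  split; first split.
  - move=> i; apply/dhomogP => m; rewrite mcoeff_msupp -(fmorph_eq0 j) -mcoeff_map_mpoly.
    rewrite yf -mcoeff_msupp; apply/dhomogP; apply: rpredZ; exact: conj_forms_homog.
  - move=> z z0; rewrite y_eval scaler_eq0 negb_or detA unitmx_mul_eq0 //=.
    by apply: EndP_eval_neq0; rewrite unitmx_mul_eq0.
  - move=> v; rewrite -(map_mx_eq0 j); have [c c0 ->] := yQ v.
    by rewrite scaler_eq0 negb_or c0 Q_nz.
  - move=> v w vw [c c0 yvw]; apply: (P_dist v w vw).
    have : proj_eq (Q v) (Q w).
      apply: proj_eq_trans (yQ v) (proj_eq_trans _ (proj_eq_sym (yQ w))).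
      by exists (j c); rewrite ?fmorph_eq0 // yvw map_mxZ.
    by move=> /(proj_eq_mulmx A); rewrite !mulKVmx.
  move=> v; apply: (@proj_eq_map_inv _ _ _ j); rewrite map_eval_forms y_eval.
  apply: proj_eq_trans _ (yQ (portrait_map v)); apply: proj_eq_sym.
  have [c c0 /= ->] := yQ (val v).
  rewrite -scalemxAr mulKVmx // (eval_forms_homog _ _ f_homog) -scalemxAr scalerA.
  apply: proj_eq_trans _ (proj_eqZ _ (_ : \det A * c ^+ d != 0)).
    by apply/proj_eq_mulmx/proj_eq_sym/P_map.
  by rewrite mulf_neq0 ?expf_neq0.
exists (invmx A) => //; split.
  exists (\det A)^-1 => [|i]; first by rewrite invr_eq0.
  have -> : forms (conj_coords (invmx A) (map_coords j y)) i =
      conj_forms (invmx A) (conj_det_forms A f) i.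
    by apply: eq_bigr => l _; rewrite /= yf.
  by rewrite (conj_conj_det_forms ch0) // scalerK.
move=> v /=; rewrite invmxK; apply: proj_eq_sym.
by have := proj_eq_mulmx A (yQ v); rewrite mulKVmx.
Qed.

End Model.

Theorem theorem16p1 (N d : nat) (hN : (1 <= N)%N) (hd : (2 <= d)%N) :
  exists C2 : nat,
    forall (P : portrait) (K : fieldExtType rat) (Kbar : closedFieldType)
      (iota : {rmorphism K -> Kbar}),
    is_algebraic_closure iota ->
    forall x : coords Kbar N (vert P),
    is_EndP_point (idfun : {rmorphism Kbar -> Kbar}) d x ->
    field_of_moduli_in iota x ->
    exists (L : fieldExtType K) (j : {rmorphism L -> Kbar}),
      [/\ forall a : K, j a%:A = iota a,
          (\dim {:L} <= C2)%N
        & field_of_definition j d x].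
Proof.
(* A label selects, for each entry of a matrix, a position in the list [rs ij] of its possible
   values. *)
exists #|{ffun 'I_N.+1 * 'I_N.+1 -> 'I_(twist_fiber_bound N d)}|.
move=> P K Kbar iota Kbar_alg x xP x_mod.
have K_char0 : [pchar K] =i pred0.
  by move=> p; rewrite pchar_lalg Num.Theory.pchar_num.
have ch0 : [pchar Kbar] =i pred0 by move=> p; rewrite (fmorph_pchar iota).
have f_homog i : forms x i \is d.-homog by case: xP => -[].
have f_nz := EndP_eval_neq0 xP.
have [idx [z [q [rs [rs_size [A0 A0_unit A0q] rsP]]]]] := twist_fiber ch0 hd f_homog f_nz.
pose g := conj_det_forms A0 (forms x).
pose Q v := invmx A0 *m pts x v.
have /fin_all_exists[e Qe] (v : vert P) : exists i, Q v i 0 != 0.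
  apply/cV0Pn; rewrite unitmx_mul_eq0 ?unitmx_inv //.
  by have [_ P_nz _ _] := xP; apply: P_nz.
(* The representative that will descend, with the coordinate [e v] of each point equal to 1. *)
pose y := Coords g (fun v => (Q v (e v) 0)^-1 *: Q v).
pose lab (s : {rmorphism Kbar -> Kbar}) (l : {ffun 'I_N.+1 * 'I_N.+1 -> 'I_(twist_fiber_bound N d)}) :=
  exists A : 'M[Kbar]_N.+1, [/\ forall ij, A ij.1 ij.2 = (rs ij)`_(l ij),
    forall i, map_mpoly s (g i) = conj_det_forms A (forms x) i
    & forall v, proj_eq (invmx A *m pts x v) (map_mx s (Q v))].
have lab_total s : in_Gal iota s -> exists l, lab s l.
  move=> /x_mod[A A_unit [[c c0 fE] PE]].
  have [mu [mu0 A'_unit gE]] := conj_det_forms_map ch0 (ltnW hd) f_homog A0_unit A_unit c0 fE.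
  set A' := mu *: _ in A'_unit gE.
  have A'_rs ij : A' ij.1 ij.2 \in rs ij.
    (* As [s] fixes the integers [q m] and the points [z m], the matrix [A'] solves the same
       equations as [A0]. *)
    apply: rsP => m; rewrite twist_conj_det_forms // mxE -gE.
    have := congr1 s (A0q m); rewrite rmorph_nat => <-.
    rewrite twist_conj_det_forms //.
    have sz : map_mx s (natvec Kbar (z m)) = natvec Kbar (z m).
      by apply/colP => i; rewrite !mxE rmorph_nat.
    have := congr1 (fun w : 'cV_N.+1 => w (idx m) 0) (map_eval_forms s g (natvec Kbar (z m))).
    by rewrite sz mxE => ->; rewrite mxE.
  have lt_idx ij : (index (A' ij.1 ij.2) (rs ij) < twist_fiber_bound N d)%N.
    by rewrite (leq_trans _ (rs_size ij)) // index_mem.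
  exists [ffun ij => Ordinal (lt_idx ij)], A'; split=> [ij|//|v].
    by rewrite ffunE nth_index.
  have sQ : map_mx s (Q v) = invmx (map_mx s A0) *m map_mx s (pts x v).
    by rewrite map_mxM map_invmx.
  have [b b0 def_v] := PE v; rewrite sQ {1}def_v.
  have -> : invmx A' *m (b *: (invmx A *m map_mx s (pts x v))) =
      (b / mu) *: (invmx (map_mx s A0) *m map_mx s (pts x v)).
    apply: (canLR (mulKmx A'_unit)).
    rewrite -scalemxAr -scalemxAl scalerA mulfVK // -mulmxA mulKVmx //.
    by rewrite map_unitmx.
  by apply/proj_eq_sym; apply: proj_eqZ; rewrite mulf_neq0 ?invr_eq0.
have [L [j [j_base dimL jP]]] := label_determined_field Kbar_alg K_char0 lab_total.
exists L, j; split=> //.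
(* A label determines the matrix, hence the conjugate forms exactly and the conjugate points up to
   scalars. *)
have lab_eq s s' l : lab s l -> lab s' l -> exists2 A : 'M[Kbar]_N.+1,
    (forall i, map_mpoly s (g i) = map_mpoly s' (g i)) &
    forall v, proj_eq (invmx A *m pts x v) (map_mx s (Q v)) /\
              proj_eq (invmx A *m pts x v) (map_mx s' (Q v)).
  move=> [A [Al gA QA]] [A' [A'l gA' QA']].
  have eqA : A' = A by apply/matrixP => i i'; rewrite (Al (i, i')) (A'l (i, i')).
  exists A => [i|v]; first by rewrite gA gA' eqA.
  by split=> //; rewrite -eqA.
have [y' y'y] : exists y', map_coords j y' = y.
  apply: coords_preimage => /= [i m|v i]; apply: jP => s s' l _ _ sl s'l.
    have [A gA _] := lab_eq _ _ _ sl s'l.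
    by rewrite -!mcoeff_map_mpoly gA.
  have [A _ /(_ v)[QA QA']] := lab_eq _ _ _ sl s'l.
  (* Automorphisms preserve the coordinate 1 of the normalized points, so these too are determined
     exactly by the label. *)
  have norm (t : {rmorphism Kbar -> Kbar}) u : proj_eq u (map_mx t (Q v)) ->
      proj_eq u (map_mx t (pts y v)) /\ map_mx t (pts y v) (e v) 0 = 1.
    move=> uQ; split; last by rewrite mxE [X in t X]mxE mulVf ?rmorph1.
    apply: proj_eq_trans uQ _; rewrite map_mxZ; apply: proj_eqZ.
    by rewrite fmorph_eq0 invr_eq0.
  have [QA1 e1] := norm _ _ QA; have [QA'1 e'1] := norm _ _ QA'.
  have := proj_eq_normalized QA1 QA'1 e1 e'1.
  by move=> /(congr1 (fun w : 'cV_N.+1 => w i 0)); rewrite mxE [RHS]mxE.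
have [] := @EndP_point_descends _ ch0 _ _ _ _ _ A0_unit xP _ j y'.
- by move=> i; rewrite y'y.
- by move=> v; rewrite y'y; apply: proj_eqZ; rewrite invr_eq0.
by move=> y'P y'x; exists y'.
Qed.
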